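(* Let $\nu,\rho,\alpha>0$. The operator $G'$ given in the context is the Fréchet derivative of $G$. That is, if $\frac{d\rho^2}{1+2\rho\nu}<\alpha$, then for every $(\mathbf{u}_h,p_h)\in\mathbf{X}_h\times Q_h$ (and every increment $(\mathbf{w}_h,s_h)\in\mathbf{X}_h\times Q_h$), $$\|G(\mathbf{u}_h+\mathbf{w}_h,p_h+s_h)-G(\mathbf{u}_h,p_h)-G'(\mathbf{u}_h,p_h;\mathbf{w}_h,s_h)\|_{\mathcal{H}_h}\le\frac{\rho\,\mathcal{M}\,C_L}{\sqrt{2K'}}\,\|(\mathbf{w}_h,s_h)\|_{\mathcal{H}_h}^2,$$ where $$K'=\min\left\{\frac12+\rho\nu-\frac{d\rho^2\alpha^{-1}}{2},\ \frac12\right\}$$ and $C_L$ is the Lipschitz constant of $G$ described in the context, taken at the base point $(\mathbf{u}_h,p_h)$.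
   Context: Let $d\in\{2,3\}$ and let $\Omega\subset\mathbb{R}^d$ be a bounded domain with Lipschitz boundary. $(\cdot,\cdot)$ and $\|\cdot\|$ denote the $L^2(\Omega)$ inner product and norm (for scalar, vector or matrix fields). Put $\mathbf{X}=[H_0^1(\Omega)]^d$ and $Q=L^2_0(\Omega)=\{q\in L^2(\Omega):\int_\Omega q=0\}$. Let $\mathbf{f}\in \mathbf{X}'$ (the dual of $\mathbf{X}$), write $(\mathbf{f},\mathbf{v})$ for the duality pairing, and let $\|\mathbf{f}\|_{-1}=\sup_{0\neq\mathbf{v}\in\mathbf{X}}|(\mathbf{f},\mathbf{v})|/\|\nabla\mathbf{v}\|$. Let $\mathbf{X}_h\subset\mathbf{X}$ and $Q_h\subset Q$ be finite-dimensional (finite element) subspaces. Skew-symmetric trilinear form: $b^*(\mathbf{u},\mathbf{v},\mathbf{w})=\tfrac12((\mathbf{u}\cdot\nabla)\mathbf{v},\mathbf{w})-\tfrac12((\mathbf{u}\cdot\nabla)\mathbf{w},\mathbf{v})$ for $\mathbf{u},\mathbf{v},\mathbf{w}\in\mathbf{X}$. Constant: $\mathcal{M}=\sup_{\mathbf{u},\mathbf{v},\mathbf{w}\in\mathbf{X}\setminus\{0\}}\frac{|(\mathbf{u}\cdot\nabla\mathbf{v},\mathbf{w})|}{\|\nabla\mathbf{u}\|\|\nabla\mathbf{v}\|\|\nabla\mathbf{w}\|}$, so that $|b^*(\mathbf{u},\mathbf{v},\mathbf{w})|\le\mathcal{M}\|\nabla\mathbf{u}\|\|\nabla\mathbf{v}\|\|\nabla\mathbf{w}\|$.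 Product space and norm: $\mathcal{H}_h=\mathbf{X}_h\times Q_h$, $\|(\mathbf{v}_h,q_h)\|_{\mathcal{H}_h}=(\|\nabla\mathbf{v}_h\|^2+\alpha\|q_h\|^2)^{1/2}$. Operator $G:\mathcal{H}_h\to\mathcal{H}_h$: for $(\mathbf{u}_h,p_h)\in\mathcal{H}_h$, $G(\mathbf{u}_h,p_h)=(\mathbf{U}_h,P_h)$, with $\mathbf{U}_h=G_1(\mathbf{u}_h,p_h)$ and $P_h=G_2(\mathbf{u}_h,p_h)$, is the unique pair in $\mathcal{H}_h$ such that, for all $(\mathbf{v}_h,q_h)\in\mathbf{X}_h\times Q_h$, $$\tfrac1\rho(\nabla(\mathbf{U}_h-\mathbf{u}_h),\nabla\mathbf{v}_h)+\nu(\nabla\mathbf{U}_h,\nabla\mathbf{v}_h)+b^*(\mathbf{u}_h,\mathbf{U}_h,\mathbf{v}_h)+\tfrac{\rho}{\alpha}(\nabla\cdot\mathbf{U}_h,\nabla\cdot\mathbf{v}_h)-(p_h,\nabla\cdot\mathbf{v}_h)=(\mathbf{f},\mathbf{v}_h),$$ $$\alpha(P_h-p_h,q_h)+\rho(\nabla\cdot\mathbf{U}_h,q_h)=0.$$ Operator $G'$: for $(\mathbf{u}_h,p_h),(\mathbf{w}_h,s_h)\in\mathcal{H}_h$, $G'(\mathbf{u}_h,p_h;\mathbf{w}_h,s_h)=(\mathbf{D}_h,E_h)$ is the pair in $\mathcal{H}_h$ such that, for all $(\mathbf{v}_h,q_h)\in\mathbf{X}_h\times Q_h$, $$(\nabla(\mathbf{D}_h-\mathbf{w}_h),\nabla\mathbf{v}_h)+\rho\nu(\nabla\mathbf{D}_h,\nabla\mathbf{v}_h)+\rho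 b^*(\mathbf{u}_h,\mathbf{D}_h,\mathbf{v}_h)+\rho b^*(\mathbf{w}_h,G_1(\mathbf{u}_h,p_h),\mathbf{v}_h)+\tfrac{\rho^2}{\alpha}(\nabla\cdot\mathbf{D}_h,\nabla\cdot\mathbf{v}_h)-\rho(s_h,\nabla\cdot\mathbf{v}_h)=0,$$ $$\alpha(E_h-s_h,q_h)+\rho(\nabla\cdot\mathbf{D}_h,q_h)=0.$$ Constant $C_L$: it is the constant of the Lipschitz estimate $\|G(x)-G(y)\|_{\mathcal{H}_h}\le C_L\|x-y\|_{\mathcal{H}_h}$ for $x,y\in\mathcal{H}_h$, namely $$C_L=\sqrt2\,\max\left\{\sqrt{\frac2K},\ \frac1{\sqrt K}\left(1+\rho\mathcal{M}\left(\|y\|_{\mathcal{H}_h}+\sqrt{\frac{\rho}{\nu}}\,\|\mathbf{f}\|_{-1}\right)\right)\right\},\qquad K=\min\left\{\frac14,\ \frac12-\frac{3d\rho^2\alpha^{-1}}{4}\right\};$$ that estimate is itself stated for parameters with $\frac{3d}{2}\rho^2<\alpha$ (equivalently $K>0$). In the claim it is used with $x=(\mathbf{u}_h+\mathbf{w}_h,p_h+s_h)$ and $y=(\mathbf{u}_h,p_h)$.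
   Formalization: The condition (3d/2)ρ² < α (equivalently K > 0), under which the context states the Lipschitz estimate defining C_L, is added; without it C_L is undefined, e.g. d=2, ρ=ν=α=1 satisfies dρ²/(1+2ρν) < α but gives K = −1. *)

(* Defs.v *)
From HB Require Import structures.
From mathcomp Require Import all_boot all_order all_algebra.
From mathcomp Require Import all_classical all_reals all_analysis.

Set Implicit Arguments.
Unset Strict Implicit.
Unset Printing Implicit Defensive.

Import Order.TTheory GRing.Theory Num.Theory.
Import numFieldNormedType.Exports.

Local Open Scope classical_set_scope.
Local Open Scope ring_scope.

(* Lebesgue measure on 'rV[R]_n: the product sigma-algebra of the coordinates
   (i.e. the Borel sets) and, by recursion on n, the image of
   lebesgue_measure \x lebesgue_rV n under (a, x) |-> the row a :: x. *)
Definition rV_display : measure_display -> measure_display.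
Proof. exact. Qed.

Section rV_measurable.
Context (R : realType) (n : nat).

Let coord (i : 'I_n) (x : 'rV[R]_n) : R := x ord0 i.

Let rV_set0 : g_sigma_preimage coord set0.
Proof. exact: sigma_algebra0. Qed.

Let rV_setC A : g_sigma_preimage coord A -> g_sigma_preimage coord (~` A).
Proof. exact: sigma_algebraC. Qed.

Let rV_bigcup (F : (set 'rV[R]_n)^nat) :
  (forall i, g_sigma_preimage coord (F i)) ->
  g_sigma_preimage coord (\bigcup_i (F i)).
Proof. exact: sigma_algebra_bigcup. Qed.

HB.instance Definition _ :=
  @isMeasurable.Build (rV_display default_measure_display) 'rV[R]_n
    (g_sigma_preimage coord) rV_set0 rV_setC rV_bigcup.

End rV_measurable.

Section rV_cons.
Context (R : realType).

Lemma measurable_coord n (i : 'I_n) :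
  measurable_fun [set: 'rV[R]_n] (fun x : 'rV[R]_n => x ord0 i).
Proof.
move=> _ Y mY; rewrite setTI; apply: sub_sigma_algebra => /=.
rewrite -bigcup_seq/=; exists i => /=; first by rewrite mem_index_enum.
by exists Y => //; rewrite setTI.
Qed.

Lemma measurable_fun_rV d (T : measurableType d) n (f : T -> 'rV[R]_n) :
  (forall i, measurable_fun [set: T] (fun t => f t ord0 i)) ->
  measurable_fun [set: T] f.
Proof.
move=> mf.
have : g_sigma_preimage (fun (i : 'I_n) t => f t ord0 i) `<=` measurable.
  apply: smallest_sub; first exact: sigma_algebra_measurable.
  case: n => [|n] in f mf *; first by rewrite big_ord0.
  rewrite -bigcup_mkord_ord; apply: bigcup_sub => i Ii.
  by move=> A [B mB <-]; exact: mf.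
rewrite (_ : (fun i t => f t ord0 i) =
  (fun i => (fun x : 'rV[R]_n => x ord0 i) \o f)) // g_sigma_preimage_comp.
by move=> sub _ A mA; apply: sub; exists A.
Qed.

Definition rV_cons n (p : measurableTypeR R * 'rV[R]_n) : 'rV[R]_n.+1 :=
  @row_mx R 1 1 n p.1%:M p.2.

Definition rV_uncons n (x : 'rV[R]_n.+1) : measurableTypeR R * 'rV[R]_n :=
  (x ord0 ord0, \row_i x ord0 (lift ord0 i)).

Lemma rV_consE n p (i : 'I_n.+1) : rV_cons p ord0 i =
  if unlift ord0 i is Some j then p.2 ord0 j else p.1.
Proof.
case: unliftP => [j ->|->]; rewrite /rV_cons.
  rewrite (_ : lift ord0 j = rshift 1 j); last exact/val_inj.
  exact: row_mxEr.
rewrite (_ : ord0 = lshift n (ord0 : 'I_1)) ?(@row_mxEl _ 1 1 n);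
  last exact/val_inj.
by rewrite mxE eqxx mulr1n.
Qed.

Lemma rV_consK n : cancel (@rV_cons n) (@rV_uncons n).
Proof.
move=> [a x]; congr pair; rewrite ?rV_consE ?unlift_none//.
by apply/rowP => i; rewrite mxE rV_consE liftK.
Qed.

Lemma measurable_rV_cons n : measurable_fun setT (@rV_cons n).
Proof.
apply: measurable_fun_rV => i.
under eq_fun do rewrite rV_consE.
case: (unlift ord0 i) => [j|]; last exact: measurable_fst.
exact: (measurableT_comp (measurable_coord j) measurable_snd).
Qed.

Lemma measurable_rV_uncons n : measurable_fun setT (@rV_uncons n).
Proof.
apply/measurable_fun_pairP; split; first exact: measurable_coord.
apply: measurable_fun_rV => i.
by under eq_fun do rewrite mxE; exact: measurable_coord.
Qed.

End rV_cons.

Section rV_lebesgue.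
Local Open Scope ereal_scope.
Context (R : realType).

Section step.
Context (n : nat) (m : {sigma_finite_measure set 'rV[R]_n -> \bar R}).

Definition lebesgue_rV_step : set 'rV[R]_n.+1 -> \bar R :=
  pushforward (@lebesgue_measure R \x m) (@rV_cons R n).

Let mu1 : {measure set (measurableTypeR R * 'rV[R]_n)%type -> \bar R} :=
  (@lebesgue_measure R \x m).

Let mcons A : measurable A -> measurable (@rV_cons R n @^-1` A).
Proof.
by move=> mA; rewrite -[X in measurable X]setTI; exact: measurable_rV_cons.
Qed.

Let step0 : lebesgue_rV_step set0 = 0.
Proof. by rewrite /lebesgue_rV_step /pushforward preimage_set0 measure0. Qed.

Let step_ge0 A : 0 <= lebesgue_rV_step A.
Proof. exact: (measure_ge0 mu1). Qed.

Let step_sigma_additive : semi_sigma_additive lebesgue_rV_step.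
Proof.
move=> F mF tF mUF; rewrite /lebesgue_rV_step /pushforward preimage_bigcup.
apply: (@measure_semi_sigma_additive _ _ _ mu1).
- by move=> k; exact: mcons.
- apply/trivIsetP => /= i j _ _ ij; rewrite -preimage_setI.
  by move/trivIsetP : tF => /(_ _ _ _ _ ij) ->//; rewrite preimage_set0.
- by rewrite -preimage_bigcup; exact: mcons.
Qed.

HB.instance Definition _ := isMeasure.Build _ _ _ lebesgue_rV_step
  step0 step_ge0 step_sigma_additive.

Let step_sigma_finite : sigma_finite setT lebesgue_rV_step.
Proof.
have /sigma_finiteP[F [TF ndF Foo]] := sigma_finiteT (@lebesgue_measure R).
have /sigma_finiteP[G [TG ndG Goo]] := sigma_finiteT m.
exists (fun k => @rV_uncons R n @^-1` (F k `*` G k)).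
  rewrite -preimage_bigcup (_ : \bigcup_k _ = setT) ?preimage_setT//.
  rewrite -setXTT TF TG predeqE => -[x y]; split.
    by move=> [k _ []/= ? ?]; split; exists k.
  move=> [/= [i _ Fix] [j _ Gjy]]; exists (maxn i j) => //; split.
  - by move: x Fix; exact/subsetPset/ndF/leq_maxl.
  - by move: y Gjy; exact/subsetPset/ndG/leq_maxr.
move=> k; have [mF ?] := Foo k; have [mG ?] := Goo k; split.
  rewrite -[X in measurable X]setTI; apply: measurable_rV_uncons => //.
  exact: measurableX.
rewrite /lebesgue_rV_step /pushforward -comp_preimage.
rewrite (_ : _ \o _ = id); last by apply/funext => x /=; rewrite rV_consK.
by rewrite preimage_id product_measure1E// lte_mul_pinfty// ge0_fin_numE.
Qed.

HB.instance Definition _ := Measure_isSigmaFinite.Build _ _ _ lebesgue_rV_step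
  step_sigma_finite.

End step.

Fixpoint lebesgue_rV n : {sigma_finite_measure set 'rV[R]_n -> \bar R} :=
  if n isn't k.+1 then \d_(0%R : 'rV[R]_0)
  else lebesgue_rV_step (lebesgue_rV k).

End rV_lebesgue.

Section domain.
Context (R : realType) (d : nat).
Local Notation E := 'rV[R]_d.

(* In suitable orthonormal coordinates y = x *m A, near every boundary point
   Om is the strict epigraph, in the direction of the k-th coordinate, of a
   Lipschitz function of the other d.-1 coordinates. *)
Definition lipschitz_boundary (Om : set E) : Prop :=
  forall x0 : E, (closure Om `\` Om^°) x0 ->
  exists (A : 'M[R]_d) (k : 'I_d) (g : 'rV[R]_d.-1 -> R) (L : R),
    [/\ A *m A^T = 1%:M, L.-lipschitz g &
        \forall x \near x0,
          Om x <-> g (col' k (x *m A)) < (x *m A) ord0 k].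

Definition bounded_lipschitz_domain (Om : set E) : Prop :=
  [/\ Om !=set0, open Om, connected Om, bounded_set Om & lipschitz_boundary Om].

Definition pderiv (i : 'I_d) (f : E -> R) : E -> R :=
  fun x => 'D_(delta_mx ord0 i) f x.

Definition smooth (f : E -> R) : Prop := forall s : seq 'I_d,
  continuous (foldr pderiv f s) /\
  forall (i : 'I_d) (x : E), derivable (foldr pderiv f s) x (delta_mx ord0 i).

Definition test_function (Om : set E) (phi : E -> R) : Prop :=
  let K := closure [set x | phi x != 0] in
  [/\ smooth phi, compact K & K `<=` Om].

End domain.

Section function_spaces.
Context (R : realType) (d : nat) (Om : set 'rV[R]_d).
Local Notation E := 'rV[R]_d.
Local Notation mu := (lebesgue_rV R d).

Definition L2 (f : E -> R) : Prop :=
  measurable_fun Om f /\ mu.-integrable Om (fun x => (f x ^+ 2)%:E).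

Definition dot (f g : E -> R) : R := \int[mu]_(x in Om) (f x * g x).

Definition L2norm (f : E -> R) : R := Num.sqrt (dot f f).

Definition frob m n (A B : 'M[R]_(m, n)) : R := \sum_i \sum_j A i j * B i j.

(* Vector fields (m = 1) and matrix fields. *)
Definition dotmx m n (F G : E -> 'M[R]_(m, n)) : R :=
  \int[mu]_(x in Om) frob (F x) (G x).

Definition L2normmx m n (F : E -> 'M[R]_(m, n)) : R := Num.sqrt (dotmx F F).

Definition weak_grad (u : E -> R) (g : E -> 'rV[R]_d) : Prop :=
  forall phi, test_function Om phi -> forall i : 'I_d,
    dot u (pderiv i phi) = - dot (fun x => g x ord0 i) phi.

(* A Sobolev function is represented together with its weak gradient; both are
   functions, the elements of the space being their classes modulo a.e.
   equality in Om. *)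
Definition H1 (u : E -> R) (g : E -> 'rV[R]_d) : Prop :=
  [/\ L2 u, forall i : 'I_d, L2 (fun x => g x ord0 i) & weak_grad u g].

Definition H10 (u : E -> R) (g : E -> 'rV[R]_d) : Prop :=
  H1 u g /\ exists phi : nat -> E -> R,
    [/\ forall n, test_function Om (phi n),
        (fun n => L2norm (phi n \- u)) @ \oo --> (0 : R) &
        forall i : 'I_d,
          (fun n => L2norm (pderiv i (phi n) \- (fun x => g x ord0 i)))
            @ \oo --> (0 : R)].

(* v.1 is the field, v.2 its gradient: (v.2 x) i j is the i-th partial
   derivative of the j-th component. *)
Definition vfield : Type := ((E -> 'rV[R]_d) * (E -> 'M[R]_d))%type.
HB.instance Definition _ := GRing.Lmodule.on vfield.
HB.instance Definition _ := Pointed.on vfield.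

Implicit Types u v w : vfield.

Definition X : set vfield := [set v : vfield | forall j : 'I_d,
  H10 (fun x => v.1 x ord0 j) (fun x => \row_i v.2 x i j)].

Definition eqX0 v : Prop := {ae mu, forall x, Om x -> v.1 x = 0}.

Definition div v : E -> R := fun x => \tr (v.2 x).

Definition gradnorm v : R := L2normmx v.2.

Definition H1norm v : R := Num.sqrt (L2normmx v.1 ^+ 2 + gradnorm v ^+ 2).

Definition Q : set (E -> R) :=
  [set q | L2 q /\ \int[mu]_(x in Om) q x = 0].

Definition dualX (f : vfield -> R) : Prop :=
  (forall (a : R) u v, X u -> X v -> f (a *: u + v) = a * f u + f v) /\
  exists C : R, forall v, X v -> `|f v| <= C * H1norm v.

Definition dualnorm (f : vfield -> R) : R :=
  sup [set z | exists v, [/\ X v, ~ eqX0 v & z = `|f v| / gradnorm v]].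

(* (u . nabla) v *)
Definition conv u v : E -> 'rV[R]_d := fun x => u.1 x *m v.2 x.

Definition bstar u v w : R :=
  2^-1 * dotmx (conv u v) w.1 - 2^-1 * dotmx (conv u w) v.1.

(* The supremum is taken in [0, +oo], with extended-real integrals, so that the
   definition does not presuppose the Sobolev embeddings that make it finite. *)
Definition Mconst : \bar R :=
  ereal_sup ([set 0%E] `|` [set z | exists u v w,
    [/\ X u /\ ~ eqX0 u, X v /\ ~ eqX0 v, X w /\ ~ eqX0 w &
      z = (`| \int[mu]_(x in Om) (frob (conv u v x) (w.1 x))%:E |
           / (gradnorm u * gradnorm v * gradnorm w)%:E)%E]]).

End function_spaces.

Definition findim_subspace (R : realType) (V : lmodType R) (A : set V) : Prop :=
  exists (n : nat) (b : 'I_n -> V),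
    A = [set \sum_i c i *: b i | c in [set: 'I_n -> R]].

Section scheme.
Context (R : realType) (d : nat) (Om : set 'rV[R]_d).
Local Notation V := (vfield R d).
Local Notation P := ('rV[R]_d -> R).
Context (f : V -> R) (Xh : set V) (Qh : set P) (nu rho alpha : R).

Definition Hnorm (y : V * P) : R :=
  Num.sqrt (gradnorm Om y.1 ^+ 2 + alpha * L2norm Om y.2 ^+ 2).

Definition G_spec (x y : V * P) : Prop :=
  forall v q, Xh v -> Qh q ->
  [/\ rho^-1 * dotmx Om (y.1 - x.1).2 v.2 + nu * dotmx Om y.1.2 v.2
        + bstar Om x.1 y.1 v + rho / alpha * dot Om (div y.1) (div v)
        - dot Om x.2 (div v) = f v &
      alpha * dot Om (y.2 - x.2) q + rho * dot Om (div y.1) q = 0].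

(* The solution is unique up to a.e. equality in Om. *)
Definition G (x : V * P) : V * P :=
  xget 0 [set y | (Xh `*` Qh) y /\ G_spec x y].

Definition G'_spec (x h y : V * P) : Prop :=
  forall v q, Xh v -> Qh q ->
  [/\ dotmx Om (y.1 - h.1).2 v.2 + rho * nu * dotmx Om y.1.2 v.2
        + rho * bstar Om x.1 y.1 v + rho * bstar Om h.1 (G x).1 v
        + rho ^+ 2 / alpha * dot Om (div y.1) (div v)
        - rho * dot Om h.2 (div v) = 0 &
      alpha * dot Om (y.2 - h.2) q + rho * dot Om (div y.1) q = 0].

Definition G' (x h : V * P) : V * P :=
  xget 0 [set y | (Xh `*` Qh) y /\ G'_spec x h y].

Definition Kconst : R :=
  Num.min 4^-1 (2^-1 - 3 * d%:R * rho ^+ 2 * alpha^-1 / 4).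

Definition K'const : R :=
  Num.min (2^-1 + rho * nu - d%:R * rho ^+ 2 * alpha^-1 / 2) 2^-1.

(* Meaningful for 0 < Kconst, i.e. 3 * d / 2 * rho ^+ 2 < alpha. *)
Definition CL (y : V * P) : \bar R :=
  (Num.sqrt 2)%:E *
  maxe (Num.sqrt (2 / Kconst))%:E
    ((Num.sqrt Kconst)^-1%:E *
     (1 + rho%:E * Mconst Om *
      (Hnorm y + Num.sqrt (rho / nu) * dualnorm Om f)%:E)).

End scheme.

(* Main.v *)
(* Let [y = G(u,p)], [x = G(u+w,p+s)] and let [e] be the difference of the
   velocities of [x], [y] and [G'(u,p;w,s)].  Subtracting the equations, the
   velocity [e] is driven by [- rho b^*(w, x_1 - y_1, .)] alone and the pressure
   difference by [div e]; testing with [e], where [b^*(u,e,e) = 0], bounds the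
   remainder by [rho M |grad w| |grad (x_1 - y_1)|].  The same test applied to
   [x - y] and to [y] gives the Lipschitz bound and the stability bound
   [|grad y_1| <= |(u,p)| + sqrt (rho / nu) |f|].  The constant [sqrt (2 K') <= 1]
   is slack.

   Nothing here shows that [Mconst] is finite.  If it is, all trilinear
   integrals converge, [b^*] is trilinear, and the discrete problems are
   solvable since their kernels are trivial up to null sets.  If it is infinite,
   the right-hand side is infinite unless the increment is null, in which case
   both sides vanish. *)
Require Import Defs.
From mathcomp Require Import all_boot all_order all_algebra.
From mathcomp Require Import all_classical all_reals all_analysis.
From mathcomp Require Import measurable_realfun.
From mathcomp Require Import ring lra.

Set Implicit Arguments.
Unset Strict Implicit.
Unset Printing Implicit Defensive.

Import Order.TTheory GRing.Theory Num.Theory.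
Import numFieldNormedType.Exports.

Local Open Scope classical_set_scope.
Local Open Scope ring_scope.

(* MathComp also has a [dotmx] (sesquilinear forms) and a [conv] (convexity). *)
Local Notation dotmx := Defs.dotmx.
Local Notation conv := Defs.conv.

(** * Lebesgue measure on row vectors *)

Section rV_measure.
Context (R : realType).

Lemma measurable_pi_rV n (A : 'I_n -> set R) : (forall i, measurable (A i)) ->
  measurable [set x : 'rV[R]_n | forall i, A i (x ord0 i)].
Proof.
move=> mA; rewrite (_ : [set _ | _] =
    \bigcap_(i in [set: 'I_n]) ((fun x : 'rV[R]_n => x ord0 i) @^-1` A i)).
  apply: fin_bigcap_measurable => [|i _]; first exact: finite_finset.
  by rewrite -[X in measurable X]setTI; apply: measurable_coord.
by apply/seteqP; split => x /= h i; [move=> _|]; exact: h.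
Qed.

(** The sigma-algebra is generated by the coordinates, so [U] is exhibited as a countable union of
    boxes, the balls of the sup norm, with rational centres and radii [1 / (m + 1)]. *)
Lemma open_measurable_rV n (U : set 'rV[R]_n) : open U -> measurable U.
Proof.
move=> oU.
pose B (q : 'rV[rat]_n * nat) : set 'rV[R]_n :=
  [set y | forall i, ball (ratr (q.1 ord0 i) : R) (q.2.+1%:R^-1) (y ord0 i)].
(* Boxes that leave [U] are replaced by the empty set, so that the union runs over a whole countable
   type. *)
pose F q := if `[< B q `<=` U >] then B q else set0.
have -> : U = \bigcup_q F q.
  apply/seteqP; split => [x Ux|x [q _]]; last first.
    by rewrite /F; case: asboolP => // BU; exact: BU.
  have /nbhs_ballP[e/= e0 xeU] : nbhs x U by exact: open_nbhs_nbhs.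
  (* With a radius below [e / 2], a box that contains [x] stays within distance [e] of [x]. *)
  have [k ke] : exists k : nat, k.+1%:R^-1 < e / 2.
    exists (Num.truncn (2 / e)); rewrite invf_plt ?posrE ?divr_gt0// invf_div.
    exact: Num.Theory.truncnS_gt.
  have k0 : 0 < k.+1%:R^-1 :> R by rewrite invr_gt0.
  have /choice[q xq] i : exists q : rat, ball (ratr q : R) k.+1%:R^-1 (x ord0 i).
    have lt : x ord0 i - k.+1%:R^-1 < x ord0 i + k.+1%:R^-1.
      by rewrite ltrD2l; apply: lt_trans k0; rewrite oppr_lt0.
    have [q] := rat_in_itvoo lt.
    rewrite in_itv/= => /andP[h1 h2]; exists q.
    rewrite /ball/= ltr_norml; apply/andP; split; move: h1 h2; move: (k.+1%:R^-1) => c *; lra.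
  exists (\row_i q i, k) => //.
  rewrite /F; case: asboolP => [_ i|]; first by rewrite /= mxE.
  case=> y By; apply: xeU; split => // i j; rewrite !ord1.
  have := By j; rewrite /= mxE => qy.
  apply: le_ball (ball_triangle (ball_sym (xq j)) qy).
  by move: ke; move: (k.+1%:R^-1) => c ?; lra.
apply: countable_bigcupT_measurable => [|q]; first exact: countableP.
rewrite /F; case: asboolP => // _.
by apply: (measurable_pi_rV (A := fun i => ball _ _)) => i; exact: measurable_ball.
Qed.

Lemma continuous_measurable_rV n (g : 'rV[R]_n -> R) :
  continuous g -> measurable_fun setT g.
Proof.
move=> cg; apply: (measurability _ (RGenOpens.measurableE R)) => _ [_ [a [b ->] <-]].
rewrite setTI; apply: open_measurable_rV; apply: open_comp => //.
Qed.

(** Induction on [n]: [rV_cons] pulls the box back to the product of an interval and a box of one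
    dimension less, and the finite measures multiply. *)
Lemma lebesgue_rV_box n (B : R) :
  measurable [set x : 'rV[R]_n | forall i, x ord0 i \in `[- B, B]] /\
  (lebesgue_rV R n [set x : 'rV[R]_n | forall i, (x ord0 i \in `[- B, B])%R] < +oo)%E.
Proof.
elim: n => [|n [mI ltI]].
  have -> : [set x : 'rV[R]_0 | forall i, x ord0 i \in `[- B, B]] = setT.
    by apply/seteqP; split => // x _ [].
  split; first exact: measurableT.
  by rewrite /= diracT ltry.
have mS : measurable [set x : 'rV[R]_n.+1 | forall i, x ord0 i \in `[- B, B]].
  exact: (@measurable_pi_rV n.+1 (fun=> [set` `[- B, B]]) (fun=> measurable_itv _)).
split => //=.
rewrite /lebesgue_rV_step /pushforward.
rewrite (_ : _ @^-1` _ = [set` `[- B, B]] `*`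
    [set x : 'rV[R]_n | forall i, x ord0 i \in `[- B, B]]); last first.
  apply/seteqP; split => [p h|p [h1 h2] i] /=; last first.
    by rewrite rV_consE; case: unliftP.
  split => /= [|i].
    by have := h ord0; rewrite rV_consE unlift_none.
  by have := h (lift ord0 i); rewrite rV_consE liftK.
have mB : measurable [set` `[- B, B]] by exact: measurable_itv.
rewrite product_measure1E// lte_mul_pinfty// ge0_fin_numE//.
rewrite /= lebesgue_measure_itv/=; case: ifP => _; last exact: ltry.
by rewrite -EFinB ltry.
Qed.

Lemma bounded_rVP n (A : set 'rV[R]_n) : bounded_set A ->
  exists2 B : R, 0 <= B & forall x i, A x -> `|x ord0 i| <= B.
Proof.
move=> /pinfty_ex_gt0[B B0 AB]; exists B; first exact: ltW.
move=> x i Ax; apply: le_trans (AB x Ax).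
rewrite [leRHS]/Num.norm/= mx_normrE; apply/bigmax_geP; right => /=.
by exists (ord0, i).
Qed.

Lemma bounded_lebesgue_rV n (A : set 'rV[R]_n) : measurable A ->
  bounded_set A -> (lebesgue_rV R n A < +oo)%E.
Proof.
move=> mA /bounded_rVP[B B0 AB].
have [mI] := lebesgue_rV_box n B; apply: le_lt_trans.
apply: le_measure; rewrite ?inE// => x Ax i.
by rewrite in_itv/= -ler_norml; exact: AB.
Qed.

End rV_measure.

(** * Square integrable functions *)

(* Cauchy-Schwarz for a positive semidefinite form that is bilinear on a
   linear subspace [S] only: the integral forms are additive only where the
   integrands are integrable. *)
Section semi_inner_product.
Context (R : realType) (V : lmodType R) (S : V -> Prop) (B : V -> V -> R).
Hypothesis S_lin : forall a u v, S u -> S v -> S (a *: u + v).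
Hypothesis B_lin : forall a u v w, S u -> S v -> S w ->
  B (a *: u + v) w = a * B u w + B v w.
Hypothesis BC : forall u v, B u v = B v u.
Hypothesis B_ge0 : forall u, 0 <= B u u.

Lemma semi_inner_CS u v : S u -> S v ->
  `|B u v| <= Num.sqrt (B u u) * Num.sqrt (B v v).
Proof.
move=> Su Sv.
have quad a : 0 <= a ^+ 2 * B u u + 2 * a * B u v + B v v.
  have := B_ge0 (a *: u + v).
  rewrite B_lin ?S_lin//; last exact: S_lin.
  rewrite (BC u) (BC v) !B_lin// (BC v u); lra.
rewrite -sqrtrM// -sqrtr_sqr ler_wsqrtr//.
(* With [B u u = 0] the polynomial is affine in [a]; were [B u v] nonzero, the chosen [a] would give
   it the value [-1]. *)
have [u0|u0] := eqVneq (B u u) 0.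
  rewrite u0 mul0r; suff -> : B u v = 0 by rewrite expr0n.
  apply/eqP/negPn/negP => uv0.
  have := quad (- (B v v + 1) / (2 * B u v)).
  have -> : 2 * (- (B v v + 1) / (2 * B u v)) * B u v = - (B v v + 1).
    by field.
  by rewrite u0 mulr0; lra.
have up : 0 < B u u by rewrite lt_def u0 B_ge0.
(* The minimiser of the quadratic polynomial. *)
have := quad (- B u v / B u u).
have -> : (- B u v / B u u) ^+ 2 * B u u + 2 * (- B u v / B u u) * B u v + B v v
  = (B u u * B v v - B u v ^+ 2) / B u u by field.
by rewrite pmulr_lge0 ?invr_gt0// subr_ge0.
Qed.

End semi_inner_product.

Section L2.
Context (R : realType) (d : nat) (Om : set 'rV[R]_d).
Hypothesis mOm : measurable Om.
Local Notation E := 'rV[R]_d.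
Local Notation mu := (lebesgue_rV R d).
Implicit Types f g h : E -> R.

(** The product is dominated by [f ^+ 2 + g ^+ 2]. *)
Lemma L2_integrableM f g : L2 Om f -> L2 Om g ->
  mu.-integrable Om (fun x => (f x * g x)%:E).
Proof.
move=> [mf f2] [mg g2].
have := integrableD mOm f2 g2; apply: le_integrable => //.
  by apply/measurable_EFinP; exact: measurable_funM.
move=> x _ /=; rewrite lee_fin ler_norml ger0_norm ?addr_ge0 ?sqr_ge0//.
by apply/andP; split; nra.
Qed.

Lemma L2_lin a f g : L2 Om f -> L2 Om g -> L2 Om (a *: f + g).
Proof.
move=> Lf Lg; have [mf f2] := Lf; have [mg g2] := Lg; split.
  apply: measurable_funD => //; apply: measurable_funM => //.
have := integrableD mOm (integrableD mOm (integrableZl mOm (a ^+ 2) f2)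
  (integrableZl mOm (2 * a) (L2_integrableM Lf Lg))) g2.
apply: eq_integrable => // x _ /=; congr _%:E.
by rewrite -[(_ + g) x]/(a * f x + g x); ring.
Qed.

Lemma L2_0 : L2 Om 0.
Proof.
split; first exact: measurable_cst.
by rewrite (_ : (fun _ => _) = cst 0%E) ?integrable0// funeqE => x/=; rewrite expr0n.
Qed.

Lemma L2D f g : L2 Om f -> L2 Om g -> L2 Om (f + g).
Proof. by move=> Lf Lg; rewrite -[f]scale1r; exact: L2_lin. Qed.

Lemma L2B f g : L2 Om f -> L2 Om g -> L2 Om (f - g).
Proof. by move=> Lf Lg; rewrite -scaleN1r addrC; exact: L2_lin. Qed.

Lemma L2_sum n (F : 'I_n -> E -> R) : (forall i, L2 Om (F i)) ->
  L2 Om (\sum_i F i).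
Proof. by move=> LF; apply: big_ind => //; [exact: L2_0|exact: L2D]. Qed.

Lemma dotC f g : dot Om f g = dot Om g f.
Proof. by apply: eq_Rintegral => x _; rewrite mulrC. Qed.

Lemma dot_lin a f g h : L2 Om f -> L2 Om g -> L2 Om h ->
  dot Om (a *: f + g) h = a * dot Om f h + dot Om g h.
Proof.
move=> Lf Lg Lh; rewrite /dot -RintegralZl//; last exact: L2_integrableM.
rewrite -RintegralD//; last 2 first.
- by have := integrableZl mOm a (L2_integrableM Lf Lh);
    apply: eq_integrable.
- exact: L2_integrableM.
by apply: eq_Rintegral => x _; rewrite -[(_ + g) x]/(a * f x + g x); ring.
Qed.

Lemma dotDl f g h : L2 Om f -> L2 Om g -> L2 Om h ->
  dot Om (f + g) h = dot Om f h + dot Om g h.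
Proof. by move=> *; rewrite -[f]scale1r dot_lin// scale1r mul1r. Qed.

Lemma dotBl f g h : L2 Om f -> L2 Om g -> L2 Om h ->
  dot Om (f - g) h = dot Om f h - dot Om g h.
Proof. by move=> *; rewrite -scaleN1r addrC dot_lin// mulN1r addrC. Qed.

Lemma dot_ge0 f : 0 <= dot Om f f.
Proof. by apply: Rintegral_ge0 => x _; rewrite -expr2 sqr_ge0. Qed.

Lemma L2norm_ge0 f : 0 <= L2norm Om f.
Proof. exact: sqrtr_ge0. Qed.

Lemma L2norm_sqr f : L2norm Om f ^+ 2 = dot Om f f.
Proof. by rewrite sqr_sqrtr// dot_ge0. Qed.

Lemma dot_CS f g : L2 Om f -> L2 Om g ->
  `|dot Om f g| <= L2norm Om f * L2norm Om g.
Proof.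
apply: semi_inner_CS => *; [exact: L2_lin|exact: dot_lin|exact: dotC|].
exact: dot_ge0.
Qed.

Lemma L2norm_eq0 f : L2 Om f -> L2norm Om f = 0 ->
  {ae mu, forall x, Om x -> f x = 0}.
Proof.
move=> Lf /eqP; rewrite sqrtr_eq0 le_eqVlt ltNge dot_ge0 orbF => /eqP f0.
have [mf f2] := Lf.
(* [dot] is the [fine] part of an extended integral, which would also be [0] for an infinite one;
   integrability rules that out. *)
have i0 : (\int[mu]_(x in Om) `|(f x ^+ 2)%:E| = 0)%E.
  rewrite (_ : (\int[mu]_(x in Om) _ = \int[mu]_(x in Om) (f x * f x)%:E)%E).
    have /fineK <- := integrable_fin_num mOm (L2_integrableM Lf Lf).
    by rewrite -[fine _]/(dot Om f f) f0.
  by apply: eq_integral => x _; rewrite gee0_abs ?lee_fin ?sqr_ge0.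
have mf2 : measurable_fun Om (fun x => (f x ^+ 2)%:E).
  by apply/measurable_EFinP/measurable_funX.
have := (ae_eq_integral_abs mu mOm mf2).1 i0.
apply: filterS => x/= h Omx; apply/eqP; rewrite -sqrf_eq0.
by have [->] := h Omx.
Qed.

(** By Cauchy-Schwarz. This carries identities from test functions over to their limits in
    $H^1_0$. *)
Lemma dot_cvg (F : nat -> E -> R) f g : (forall n, L2 Om (F n)) -> L2 Om f ->
  L2 Om g -> (fun n => L2norm Om (F n - f)) @ \oo --> (0 : R) ->
  (fun n => dot Om (F n) g) @ \oo --> dot Om f g.
Proof.
move=> LF Lf Lg F0; apply/cvgrPdist_le => /= e e0.
have Fg : (fun n => L2norm Om (F n - f) * L2norm Om g) @ \oo --> (0 : R).
  by rewrite -[X in _ --> X](mul0r (L2norm Om g)); apply: cvgMl.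
move/cvgrPdist_le : Fg => /(_ _ e0); apply: filterS => n /=.
rewrite sub0r normrN ger0_norm ?mulr_ge0 ?L2norm_ge0// => Fn.
rewrite distrC -dotBl//; apply: le_trans Fn; apply: dot_CS => //; exact: L2B.
Qed.

End L2.

(** * Test functions and the Poincare inequality *)

Section test_functions.
Context (R : realType) (d : nat).
Local Notation E := 'rV[R]_d.
Implicit Types (f g : E -> R) (i k : 'I_d).

(** A list of derivatives applied to [pderiv i f] is that list with [i] appended at the end, applied
    to [f]. *)
Lemma smooth_pderiv i f : smooth f -> smooth (pderiv i f).
Proof. by move=> sf s; have := sf (rcons s i); rewrite foldr_rcons. Qed.

Lemma smooth_foldr s f : smooth f -> smooth (foldr (@pderiv R d) f s).
Proof.
by move=> sf; elim: s => [|i s IH]; [exact: sf|exact: (smooth_pderiv i IH)].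
Qed.

Lemma smooth_continuous f : smooth f -> continuous f.
Proof. by move=> /(_ [::])[]. Qed.

Lemma smooth_derivable f i x : smooth f -> derivable f x (delta_mx ord0 i).
Proof. by move=> /(_ [::])[_]. Qed.
Arguments smooth_derivable [f] i x _.

Lemma pderivD i f g : smooth f -> smooth g ->
  pderiv i (f + g) = pderiv i f + pderiv i g.
Proof.
move=> sf sg; apply/funext => x.
have dfx := smooth_derivable i x sf; have dgx := smooth_derivable i x sg.
by rewrite /pderiv deriveD.
Qed.

Lemma smoothD f g : smooth f -> smooth g -> smooth (f + g).
Proof.
move=> sf sg s.
have -> : foldr (@pderiv R d) (f + g) s =
    foldr (@pderiv R d) f s + foldr (@pderiv R d) g s.
  elim: s => //= i s ->.
  exact: (pderivD i (smooth_foldr s sf) (smooth_foldr s sg)).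
split => [x|i x].
  by apply: continuousD; [exact: (smooth_continuous (smooth_foldr s sf))|
    exact: (smooth_continuous (smooth_foldr s sg))].
have dfx := smooth_derivable i x (smooth_foldr s sf).
have dgx := smooth_derivable i x (smooth_foldr s sg).
exact: derivableD.
Qed.

Lemma smoothZ (c : R) f : smooth f -> smooth (c *: f).
Proof.
move=> sf s.
have -> : foldr (@pderiv R d) (c *: f) s = c *: foldr (@pderiv R d) f s.
  elim: s => //= i s ->; apply/funext => x; 
  have dfx := smooth_derivable i x (smooth_foldr s sf).
  by rewrite /pderiv deriveZ.
split => [x|i x].
  apply: (continuousM (s := cst c)); first exact: cst_continuous.
  exact: (smooth_continuous (smooth_foldr s sf)).
have dfx := smooth_derivable i x (smooth_foldr s sf).
exact: derivableZ.
Qed.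

Lemma is_derive_coord k (x v : E) :
  is_derive x v (fun y : E => y ord0 k) (v ord0 k).
Proof.
have idd : derivable (id : E -> E) x v by exact: derivable_id.
 split; first exact: ((derivable_mxP _ _ _).1 idd).
have := derive_mx idd; rewrite derive_id => /matrixP/(_ ord0 k).
by rewrite mxE => <-.
Qed.

Lemma coordM_derivable k f x i : smooth f ->
  derivable ((fun y : E => y ord0 k) * f) x (delta_mx ord0 i).
Proof.
move=> sf; have dfx := smooth_derivable i x sf.
have [dx _] := is_derive_coord k x (delta_mx ord0 i).
exact: (derivableM dx dfx).
Qed.
Arguments coordM_derivable k [f] x i _.

Lemma pderiv_coordM i k f : smooth f ->
  pderiv i ((fun y : E => y ord0 k) * f) =
    (fun y : E => y ord0 k) * pderiv i f + (k == i)%:R *: f.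
Proof.
move=> sf; apply/funext => x; rewrite /pderiv.
have [dx ex] := is_derive_coord k x (delta_mx ord0 i).
have dfx := smooth_derivable i x sf.
rewrite (deriveM dx dfx) ex mxE eqxx andTb.
by congr (_ + _); exact: mulrC.
Qed.

Lemma smooth_coordM k f : smooth f -> smooth ((fun y : E => y ord0 k) * f).
Proof.
move=> sf s.
(* Derivatives commute with multiplication by [x_k] up to a smooth remainder, to which each index
   equal to [k] contributes a lower-order derivative of [f]; this replaces an explicit Leibniz
   formula. *)
have [g sg ->] : exists2 g, smooth g & foldr (@pderiv R d)
    ((fun y : E => y ord0 k) * f) s =
    (fun y : E => y ord0 k) * foldr (@pderiv R d) f s + g.
  elim: s => [|i s [g sg IH]] /=.
    exists (0 *: f); first exact: smoothZ.
    by rewrite scale0r addr0.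
  have sD := smooth_foldr s sf.
  exists ((k == i)%:R *: foldr (@pderiv R d) f s + pderiv i g).
    by apply: smoothD; [exact: smoothZ|exact: smooth_pderiv].
  rewrite IH addrA -(pderiv_coordM i k sD); apply/funext => x.
  have dfx := coordM_derivable k x i sD; have dgx := smooth_derivable i x sg.
  by rewrite /pderiv (deriveD dfx dgx).
have sD := smooth_foldr s sf.
split => [x|i x].
  apply: continuousD; last exact: (smooth_continuous sg).
  by apply: continuousM; [exact: coord_continuous|
    exact: (smooth_continuous sD)].
have dfx := coordM_derivable k x i sD; have dgx := smooth_derivable i x sg.
exact: (derivableD dfx dgx).
Qed.

Variable Om : set E.

Lemma test_function_sub f g : smooth g ->
  [set x | g x != 0] `<=` closure [set x | f x != 0] ->
  test_function Om f -> test_function Om g.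
Proof.
move=> sg gf [sf cK KO].
have gK : closure [set x | g x != 0] `<=` closure [set x | f x != 0].
  rewrite [X in _ `<=` X]((closure_id _).1 (@closed_closure _ _)).
  exact: closureS.
split => //; last exact: subset_trans KO.
by apply: subclosed_compact cK gK; exact: closed_closure.
Qed.

Lemma test_function_pderiv i f :
  test_function Om f -> test_function Om (pderiv i f).
Proof.
move=> tf; have [sf _ _] := tf.
apply: test_function_sub tf; first exact: smooth_pderiv.
move=> x /= fx; apply: contrapT => xK; move/eqP : fx; apply.
(* Off the closed support [f] vanishes in a whole neighbourhood, so its derivative there is that of
   a constant. *)
have nx : \forall y \near x, f y = cst 0 y.
  have oK : open (~` closure [set x | f x != 0]).
    exact/closed_openC/closed_closure.
  have : nbhs x (~` closure [set x | f x != 0]) by exact: open_nbhs_nbhs.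
  apply: filterS => y yK; apply/eqP/negPn/negP => fy.
  by apply: yK; exact: subset_closure.
by rewrite /pderiv (near_eq_derive _ nx) derive_cst.
Qed.

Lemma test_function_coordM k f : test_function Om f ->
  test_function Om ((fun y : E => y ord0 k) * f).
Proof.
move=> tf; have [sf _ _] := tf.
apply: test_function_sub tf; first exact: smooth_coordM.
move=> x /= fx; apply: subset_closure => /=; apply: contra_neq fx => fx.
by rewrite -[_ x]/(x ord0 k * f x) fx mulr0.
Qed.

Hypothesis (mOm : measurable Om) (bOm : bounded_set Om).

(** A continuous function with compact support is bounded, and [Om] has finite measure. *)
Lemma test_function_L2 f : test_function Om f -> L2 Om f.
Proof.
move=> [/smooth_continuous cf cK _].
have [M M0 fM] : exists2 M : R, 0 <= M & forall x, `|f x| <= M.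
  have /compact_bounded/pinfty_ex_gt0[M M0 fM] : compact (f @` closure [set x | f x != 0]).
    by apply: continuous_compact => //; exact: continuous_subspaceT.
  exists M => [|x]; first exact: ltW.
  have [->|fx] := eqVneq (f x) 0; first by rewrite normr0 ltW.
  by apply: fM; exists x => //; exact: subset_closure.
have mf : measurable_fun Om f.
  by apply: measurable_funTS; exact: continuous_measurable_rV.
split => //; apply: measurable_bounded_integrable => //.
- exact: bounded_lebesgue_rV.
- exact: measurable_funX.
- exists (M ^+ 2); split; first exact: num_real.
  move=> N MN x _ /=; rewrite ger0_norm ?sqr_ge0//; apply: le_trans (ltW MN).
  by rewrite -real_normK ?num_real// ler_pXn2r ?nnegrE.
Qed.

Lemma coordM_L2 k f : L2 Om f -> L2 Om ((fun y : E => y ord0 k) * f).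
Proof.
move=> Lf; have [mf _] := Lf; have [B B0 xB] := bounded_rVP bOm.
have mx : measurable_fun Om (fun y : E => y ord0 k).
  by apply: measurable_funTS; exact: measurable_coord.
split; first exact: measurable_funM.
have := integrableZl mOm (B ^+ 2) Lf.2; apply: le_integrable => //.
  by apply/measurable_EFinP/measurable_funX; exact: measurable_funM.
move=> x Ox /=; rewrite lee_fin -[(_ * f) x]/(x ord0 k * f x) exprMn.
rewrite !ger0_norm; do ?exact: (mulr_ge0 (sqr_ge0 _) (sqr_ge0 _)).
rewrite ler_wpM2r ?sqr_ge0//.
by rewrite -[leLHS]real_normK ?num_real// ler_pXn2r ?nnegrE//; exact: xB.
Qed.

Lemma L2norm_coordM k f B : 0 <= B -> (forall x, Om x -> `|x ord0 k| <= B) ->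
  L2 Om f -> L2norm Om ((fun y : E => y ord0 k) * f) <= B * L2norm Om f.
Proof.
move=> B0 xB Lf; rewrite -(ler_pXn2r (n := 2)) ?nnegrE ?mulr_ge0 ?L2norm_ge0//.
rewrite exprMn !L2norm_sqr /dot -RintegralZl//; last exact: L2_integrableM.
apply: le_Rintegral => //.
- by have := L2_integrableM mOm (coordM_L2 k Lf) (coordM_L2 k Lf).
- by have := integrableZl mOm (B ^+ 2) (L2_integrableM mOm Lf Lf).
move=> x Ox; rewrite -[(_ * f) x]/(x ord0 k * f x).
have : x ord0 k ^+ 2 <= B ^+ 2.
  by rewrite -real_normK ?num_real// ler_pXn2r ?nnegrE//; exact: xB.
by move=> h; have := sqr_ge0 (f x); nra.
Qed.

(* Testing the definition of the weak gradient with [x_k phi_n], where the test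
   functions [phi_n] tend to [u] in H^1, gives [|u|^2 = - 2 (x_k g_k, u)]. *)
Lemma H10_poincare u (g : E -> 'rV[R]_d) k (B : R) : 0 <= B ->
  (forall x, Om x -> `|x ord0 k| <= B) -> H10 Om u g ->
  L2norm Om u <= 2 * B * L2norm Om (fun x => g x ord0 k).
Proof.
move=> B0 xB [[Lu Lg wg] [phi [tphi phiu phig]]].
have Lphi n : L2 Om (phi n) by exact: test_function_L2.
have Ldphi n i : L2 Om (pderiv i (phi n)).
  exact/test_function_L2/test_function_pderiv.
pose gk : E -> R := fun x => g x ord0 k.
pose X : E -> R := fun y => y ord0 k.
have key n : dot Om (pderiv k (phi n)) (X * u) + dot Om (phi n) u =
    - dot Om (phi n) (X * gk).
  have := wg _ (test_function_coordM k (tphi n)) k.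
  have sphi : smooth (phi n) by case: (tphi n).
  rewrite pderiv_coordM// eqxx scale1r dotC dotDl//; last exact: coordM_L2.
  rewrite -/X -/gk (_ : dot Om (X * pderiv k (phi n)) u = dot Om (pderiv k (phi n)) (X * u)).
    move=> ->; congr (- _); apply: eq_Rintegral => x _.
    by rewrite -[(X * phi n) x]/(X x * phi n x) -[(X * gk) x]/(X x * gk x); ring.
  apply: eq_Rintegral => x _.
  by rewrite -[(X * pderiv k (phi n)) x]/(X x * pderiv k (phi n) x)
     -[(X * u) x]/(X x * u x); ring.
have LXu := coordM_L2 k Lu; have LXg := coordM_L2 k (Lg k).
(* The limit of [key]: each of its two sides converges, and limits are unique. *)
have e : dot Om gk (X * u) + dot Om u u = - dot Om u (X * gk).
  have h1 : (fun n => - dot Om (phi n) (X * gk)) @ \oo -->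
      dot Om gk (X * u) + dot Om u u.
    under eq_fun do rewrite -key; apply: cvgD.
      exact: (dot_cvg mOm (fun n => Ldphi n k) (Lg k) LXu (phig k)).
    exact: (dot_cvg mOm Lphi Lu Lu phiu).
  have h2 : (fun n => - dot Om (phi n) (X * gk)) @ \oo --> - dot Om u (X * gk).
    by apply: cvgN; exact: (dot_cvg mOm Lphi Lu LXg phiu).
  by rewrite -(cvg_lim (@norm_hausdorff _ R^o) h1) -(cvg_lim (@norm_hausdorff _ R^o) h2).
have {e} : L2norm Om u ^+ 2 = - 2 * dot Om gk (X * u).
  rewrite L2norm_sqr.
  have -> : dot Om gk (X * u) = dot Om u (X * gk).
    apply: eq_Rintegral => x _.
    by rewrite -[(X * gk) x]/(X x * gk x) -[(X * u) x]/(X x * u x); ring.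
  have -> : dot Om u u = - dot Om u (X * gk) - dot Om gk (X * u) by lra.
  have -> : dot Om gk (X * u) = dot Om u (X * gk).
    apply: eq_Rintegral => x _.
    by rewrite -[(X * gk) x]/(X x * gk x) -[(X * u) x]/(X x * u x); ring.
  lra.
move=> e; have := dot_CS mOm (Lg k) LXu.
have := L2norm_coordM B0 xB Lu.
(* The estimate $\|u\|^2\le 2B\|g_k\|\|u\|$ is to be divided by $\|u\|$, so the case $\|u\|=0$ is
   set aside. *)
have := L2norm_ge0 Om u; rewrite le_eqVlt => /predU1P[<- _ _|u0 h1 h2].
  by rewrite !mulr_ge0// L2norm_ge0.
rewrite -(ler_pM2r u0) -expr2 e.
have := ler_norm (- dot Om gk (X * u)); rewrite normrN.
have := ler_wpM2l (L2norm_ge0 Om gk) h1.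
by rewrite -/gk -/X in h2 *; lra.
Qed.

(* Testing the definition of the weak gradient with [d_i phi_n]. *)
Lemma H10_null_grad u (g : E -> 'rV[R]_d) i :
  {ae lebesgue_rV R d, forall x, Om x -> u x = 0} -> H10 Om u g ->
  L2norm Om (fun x => g x ord0 i) = 0.
Proof.
move=> u0 [[Lu Lg wg] [phi [tphi _ phig]]].
have du0 v : L2 Om v -> dot Om u v = 0.
  move=> Lv; rewrite /dot /Rintegral (ae_eq_integral (cst 0%E)) ?integral0//.
    exact: measurable_int (L2_integrableM mOm Lu Lv).
  by apply: filterS u0 => x/= h /h ->; rewrite mul0r.
have L n j (h := pderiv j (phi n)) : L2 Om h /\ L2 Om (pderiv j h).
  by split; apply: test_function_L2; rewrite /h; do ?exact: test_function_pderiv;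
    do 2 apply: test_function_pderiv.
have h1 := dot_cvg mOm (fun n => (L n i).1) (Lg i) (Lg i) (phig i).
(* The other side of the weak-gradient identity pairs a second derivative of [phi n] with the null
   function [u]. *)
have z n : dot Om (pderiv i (phi n)) (fun x => g x ord0 i) = 0.
  have := wg _ (test_function_pderiv i (tphi n)) i.
  rewrite du0; last exact: (L n i).2.
  by rewrite dotC => /eqP; rewrite eq_sym oppr_eq0 => /eqP.
have : dot Om (fun x => g x ord0 i) (fun x => g x ord0 i) = 0.
  have h2 : (fun n => dot Om (pderiv i (phi n)) (fun x => g x ord0 i)) @ \oo -->
      (0 : R).
    by under eq_fun do rewrite z; exact: cvg_cst.
  by rewrite -(cvg_lim (@norm_hausdorff _ R^o) h1) -(cvg_lim (@norm_hausdorff _ R^o) h2).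
by rewrite /L2norm => ->; rewrite sqrtr0.
Qed.

End test_functions.

(** * Vector fields *)

Section L2_matrix_fields.
Context (R : realType) (d : nat) (Om : set 'rV[R]_d).
Hypothesis mOm : measurable Om.
Local Notation E := 'rV[R]_d.
Local Notation mu := (lebesgue_rV R d).

Definition L2mx m n (F : E -> 'M[R]_(m, n)) : Prop :=
  forall i j, L2 Om (fun x => F x i j).

(** Integrability and value are carried through the sum together, since the integral is additive on
    integrable functions only. *)
Lemma Rintegral_sum (I : finType) (F : I -> E -> R) :
  (forall i, mu.-integrable Om (fun x => (F i x)%:E)) ->
  mu.-integrable Om (fun x => (\sum_i F i x)%:E) /\
  \int[mu]_(x in Om) (\sum_i F i x) = \sum_i \int[mu]_(x in Om) F i x.
Proof.
move=> iF.
pose P (f : E -> R) r := mu.-integrable Om (fun x => (f x)%:E) /\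
  \int[mu]_(x in Om) f x = r.
suff : P (\sum_i F i) (\sum_i \int[mu]_(x in Om) F i x) by rewrite fct_sumE.
apply: (big_ind2 P) => [|f r g s [fi <-] [gi <-]|i _]; last by split.
  by split; [exact: integrable0|rewrite /Rintegral integral0].
by split; [exact: (integrableD mOm fi gi)|exact: RintegralD].
Qed.

Section fixed_size.
Context (m n : nat).
Implicit Types F G H : E -> 'M[R]_(m, n).

Lemma L2mx_lin a F G : L2mx F -> L2mx G -> L2mx (a *: F + G).
Proof.
move=> LF LG i j; have := L2_lin mOm a (LF i j) (LG i j).
by congr (L2 Om _); apply/funext => x; rewrite -[(_ + G) x]/(a *: F x + G x) !mxE.
Qed.

Lemma dotmxE F G : L2mx F -> L2mx G -> dotmx Om F G =
  \sum_i \sum_j dot Om (fun x => F x i j) (fun x => G x i j).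
Proof.
move=> LF LG; rewrite /dotmx /frob.
have iFG i j : mu.-integrable Om (fun x => (F x i j * G x i j)%:E).
  exact: (L2_integrableM mOm (LF i j) (LG i j)).
rewrite (Rintegral_sum (fun i => (Rintegral_sum (iFG i)).1)).2.
by apply: eq_bigr => i _; rewrite (Rintegral_sum (iFG i)).2.
Qed.

Lemma dotmxC F G : dotmx Om F G = dotmx Om G F.
Proof.
by apply: eq_Rintegral => x _; apply: eq_bigr => i _; apply: eq_bigr => j _;
  rewrite mulrC.
Qed.

Lemma dotmx_lin a F G H : L2mx F -> L2mx G -> L2mx H ->
  dotmx Om (a *: F + G) H = a * dotmx Om F H + dotmx Om G H.
Proof.
move=> LF LG LH; rewrite !dotmxE//; last exact: L2mx_lin.
rewrite mulr_sumr -big_split; apply: eq_bigr => i _.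
rewrite mulr_sumr -big_split; apply: eq_bigr => j _.
rewrite /= -(dot_lin mOm)//; congr dot; apply/funext => x.
by rewrite -[(a *: F + G) x]/(a *: F x + G x) !mxE.
Qed.

Lemma dotmx_ge0 F : 0 <= dotmx Om F F.
Proof.
apply: Rintegral_ge0 => x _; apply: sumr_ge0 => i _; apply: sumr_ge0 => j _.
by rewrite -expr2 sqr_ge0.
Qed.

Lemma dotmx_CS F G : L2mx F -> L2mx G ->
  `|dotmx Om F G| <= L2normmx Om F * L2normmx Om G.
Proof.
apply: semi_inner_CS => *; [exact: L2mx_lin|exact: dotmx_lin|exact: dotmxC|].
exact: dotmx_ge0.
Qed.

Lemma L2normmx_sqr F : L2normmx Om F ^+ 2 = dotmx Om F F.
Proof. by rewrite sqr_sqrtr// dotmx_ge0. Qed.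

Lemma L2norm_entry_le F i j : L2mx F ->
  L2norm Om (fun x => F x i j) <= L2normmx Om F.
Proof.
move=> LF; rewrite ler_wsqrtr// dotmxE// (bigD1 i)//= (bigD1 j)//= -addrA.
rewrite lerDl addr_ge0// ?sumr_ge0// => [? _|? _]; first exact: dot_ge0.
by rewrite sumr_ge0// => ? _; exact: dot_ge0.
Qed.

End fixed_size.
End L2_matrix_fields.

Section vector_fields.
Context (R : realType) (d : nat) (Om : set 'rV[R]_d).
Hypotheses (mOm : measurable Om) (bOm : bounded_set Om).
Local Notation E := 'rV[R]_d.
Local Notation mu := (lebesgue_rV R d).
Implicit Types u v w : vfield R d.

Lemma X_L2 v j : X Om v -> L2 Om (fun x => v.1 x ord0 j).
Proof. by move=> /(_ j)[[]]. Qed.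

Lemma X_L2mx1 v : X Om v -> L2mx Om v.1.
Proof. by move=> Xv i j; rewrite ord1; exact: X_L2. Qed.

Lemma X_L2mx2 v : X Om v -> L2mx Om v.2.
Proof.
move=> Xv i j; have [[_ /(_ i) + _] _] := Xv j.
by congr (L2 Om _); apply/funext => x; rewrite mxE.
Qed.

Lemma X_L2div v : X Om v -> L2 Om (div v).
Proof.
move=> Xv; have := L2_sum mOm (fun i => X_L2mx2 Xv i i).
by rewrite fct_sumE.
Qed.

Lemma gradnorm_ge0 v : 0 <= gradnorm Om v.
Proof. exact: sqrtr_ge0. Qed.

Lemma gradnorm_sqr v : gradnorm Om v ^+ 2 = dotmx Om v.2 v.2.
Proof. exact: L2normmx_sqr. Qed.

(** The component $v_j$ is estimated by its own derivative $\partial_j v_j$, so the sum over $j$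
    sees only the diagonal of the gradient: $\|v\|^2\le 4B^2\|\nabla v\|^2$. The extra [1] in the
    constant is for the gradient part of the $H^1$ norm. *)
Lemma poincare : exists2 C : R, 0 <= C &
  forall v, X Om v -> H1norm Om v <= C * gradnorm Om v.
Proof.
have [B B0 xB] := bounded_rVP bOm.
exists (Num.sqrt (4 * B ^+ 2 + 1)) => [|v Xv]; first exact: sqrtr_ge0.
rewrite -[gradnorm Om v in leRHS]ger0_norm ?gradnorm_ge0// -sqrtr_sqr.
rewrite -sqrtrM; last by rewrite addr_ge0// mulr_ge0// sqr_ge0.
rewrite ler_wsqrtr// mulrDl mul1r lerD2r gradnorm_sqr L2normmx_sqr.
rewrite (dotmxE mOm (X_L2mx1 Xv) (X_L2mx1 Xv)) big_ord1.
rewrite (dotmxE mOm (X_L2mx2 Xv) (X_L2mx2 Xv)) mulr_sumr ler_sum// => j _.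
rewrite (bigD1 j)//= mulrDr; apply: ler_wpDr.
  rewrite mulr_ge0 ?(mulr_ge0 _ (sqr_ge0 _))//.
  by apply: sumr_ge0 => i _; exact: dot_ge0.
have := H10_poincare mOm bOm B0 (fun x => xB x j) (Xv j).
have -> : (fun x => (\row_i v.2 x i j) ord0 j) = (fun x => v.2 x j j).
  by apply/funext => x; rewrite mxE.
rewrite -!L2norm_sqr => h.
have := L2norm_ge0 Om (fun x => v.1 x ord0 j) => h0.
by nra.
Qed.

(** Poincare's inequality gives one direction and [H10_null_grad] the other. It links the nonzero
    fields in the definition of [Mconst] to nonzero denominators. *)
Lemma gradnorm_eq0P v : X Om v -> gradnorm Om v = 0 <-> eqX0 Om v.
Proof.
move=> Xv; split => [v0|v0].
  have [C C0 /(_ _ Xv)] := poincare; rewrite v0 mulr0 => h.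
  have n0 : L2normmx Om v.1 = 0.
    apply/eqP; rewrite -sqrf_eq0; apply/eqP.
    have : H1norm Om v == 0 by rewrite eq_le h sqrtr_ge0.
    rewrite sqrtr_eq0 v0 expr0n addr0 => h1; apply/eqP.
    by rewrite eq_le h1 sqr_ge0.
  have z j : {ae mu, forall x, Om x -> v.1 x ord0 j = 0}.
    apply: (L2norm_eq0 mOm); first exact: X_L2.
    apply/eqP; rewrite eq_le L2norm_ge0 andbT -n0.
    exact: (L2norm_entry_le mOm ord0 j (X_L2mx1 Xv)).
  have : {ae mu, forall x j, Om x -> v.1 x ord0 j = 0} by exact: filter_forall.
  by apply: filterS => x xj Ox; apply/rowP => j; rewrite mxE xj.
have z i j : L2norm Om (fun x => v.2 x i j) = 0.
  have vj0 : {ae mu, forall x, Om x -> v.1 x ord0 j = 0}.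
    by apply: filterS v0 => x h /h ->; rewrite mxE.
  have := H10_null_grad mOm bOm i vj0 (Xv j).
  by under eq_fun do rewrite mxE.
apply/eqP; rewrite -sqrf_eq0 gradnorm_sqr.
rewrite (dotmxE mOm (X_L2mx2 Xv) (X_L2mx2 Xv)) big1// => i _.
by rewrite big1// => j _; rewrite -L2norm_sqr z expr0n.
Qed.

(** * The trilinear integrand and its bound by [Mconst] *)

Definition triple u v w : E -> R := fun x => frob (conv u v x) (w.1 x).

Lemma tripleE u v w x :
  triple u v w x = \sum_j (\sum_k u.1 x ord0 k * v.2 x k j) * w.1 x ord0 j.
Proof. by rewrite /triple /frob big_ord1; apply: eq_bigr => j _; rewrite mxE. Qed.

Lemma measurable_triple u v w : X Om u -> X Om v -> X Om w ->
  measurable_fun Om (triple u v w).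
Proof.
move=> Xu Xv Xw; rewrite (funext (tripleE u v w)).
apply: measurable_sum => j; apply: measurable_funM.
  apply: measurable_sum => k; apply: measurable_funM.
    by case: (X_L2 k Xu).
  by case: (X_L2mx2 Xv k j).
by case: (X_L2 j Xw).
Qed.

Lemma grad_ae0 v : X Om v -> gradnorm Om v = 0 ->
  {ae mu, forall x, Om x -> v.2 x = 0}.
Proof.
move=> Xv v0.
have z i j : {ae mu, forall x, Om x -> v.2 x i j = 0}.
  apply: (L2norm_eq0 mOm); first exact: (X_L2mx2 Xv).
  apply/eqP; rewrite eq_le L2norm_ge0 andbT -v0.
  exact: (L2norm_entry_le mOm i j (X_L2mx2 Xv)).
have : {ae mu, forall x i j, Om x -> v.2 x i j = 0}.
  by do 2 apply: filter_forall => ?.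
by apply: filterS => x xj Ox; apply/matrixP => i j; rewrite mxE xj.
Qed.

Lemma triple_ae0 u v w : X Om u -> X Om v -> X Om w ->
  gradnorm Om u = 0 \/ gradnorm Om v = 0 \/ gradnorm Om w = 0 ->
  {ae mu, forall x, Om x -> triple u v w x = 0}.
Proof.
move=> Xu Xv Xw [/(gradnorm_eq0P Xu)|[/(grad_ae0 Xv)|/(gradnorm_eq0P Xw)]];
  apply: filterS => x h /h; rewrite tripleE => ->; apply: big1 => j _.
- by rewrite big1 ?mul0r// => k _; rewrite mxE mul0r.
- by rewrite big1 ?mul0r// => k _; rewrite mxE mulr0.
- by rewrite mxE mulr0.
Qed.

Lemma Mconst_ge0 : (0 <= Mconst Om)%E.
Proof. by apply: ereal_sup_ubound; left. Qed.

(** If one gradient is null, the integrand vanishes almost everywhere. Otherwise the quotient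
    belongs to the set whose supremum is [Mconst], and the bound on the extended integral makes it
    finite. *)
Lemma Mconst_fin (M : R) u v w : Mconst Om = M%:E ->
  X Om u -> X Om v -> X Om w ->
  mu.-integrable Om (fun x => (triple u v w x)%:E) /\
  `|dotmx Om (conv u v) w.1| <=
    M * gradnorm Om u * gradnorm Om v * gradnorm Om w.
Proof.
move=> MM Xu Xv Xw.
have M0 : 0 <= M by rewrite -lee_fin -MM Mconst_ge0.
have mt := measurable_triple Xu Xv Xw.
have [guvw0|guvw0] := eqVneq (gradnorm Om u * gradnorm Om v * gradnorm Om w) 0.
  have t0 : ae_eq mu Om (fun x => (triple u v w x)%:E) (cst 0%E).
    have z : gradnorm Om u = 0 \/ gradnorm Om v = 0 \/ gradnorm Om w = 0.
      by move/eqP: guvw0; rewrite !mulf_eq0 -orbA => /or3P[]/eqP->; tauto.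
    by apply: filterS (triple_ae0 Xu Xv Xw z) => x h /h ->.
  have mt' : measurable_fun Om (fun x => (triple u v w x)%:E) by exact/measurable_EFinP.
  split.
    apply/integrableP; split => //.
    by rewrite ((ae_eq_integral_abs mu mOm mt').2 t0) ltry.
  rewrite -!(mulrA M) guvw0 mulr0.
  rewrite /dotmx /Rintegral (ae_eq_integral (cst 0%E))// integral0.
  by rewrite normr0.
move: guvw0; rewrite !mulf_eq0 !negb_or => /andP[/andP[gu gv] gw].
have nz v' : X Om v' -> gradnorm Om v' != 0 -> ~ eqX0 Om v'.
  by move=> Xv' /eqP + /(gradnorm_eq0P Xv').
have gt0 : 0 < gradnorm Om u * gradnorm Om v * gradnorm Om w.
  by rewrite !mulr_gt0// lt_def gradnorm_ge0 ?gu ?gv ?gw.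
have : (`| \int[mu]_(x in Om) (triple u v w x)%:E | /
    (gradnorm Om u * gradnorm Om v * gradnorm Om w)%:E <= M%:E)%E.
  rewrite -MM; apply: ereal_sup_ubound; right; exists u, v, w.
  by split => //; split => //; exact: nz.
rewrite inver gt_eqF// lee_pdivrMr// -EFinM => le.
have fin : (\int[mu]_(x in Om) (triple u v w x)%:E)%E \is a fin_num.
  by rewrite fin_num_abs (le_lt_trans le)// ltry.
split; last first.
  by move: le; rewrite -(fineK fin) -!(mulrA M).
have mt' : measurable_fun Om (fun x => (triple u v w x)%:E) by exact/measurable_EFinP.
(* An extended integral is finite only if those of the positive and negative parts are. *)
by apply/integrableP; split => //; rewrite integral_fin_num_abs.
Qed.

End vector_fields.

(** * Finite-dimensional problems and the trilinear form *)

Section findim.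
Context (R : realType) (V : lmodType R) (A : set V).
Hypothesis hA : findim_subspace A.

Lemma findim_lin a u v : A u -> A v -> A (a *: u + v).
Proof.
have [n [b ->]] := hA => -[c _ <-] [c' _ <-].
exists (fun i => a * c i + c' i) => //; rewrite scaler_sumr -big_split/=.
by apply: eq_bigr => i _; rewrite scalerDl scalerA.
Qed.

Lemma findim0 : A 0.
Proof.
have [n [b ->]] := hA; exists (fun=> 0) => //.
by rewrite big1// => i _; rewrite scale0r.
Qed.

Lemma findimB u v : A u -> A v -> A (u - v).
Proof. by move=> Au Av; rewrite addrC -scaleN1r; exact: findim_lin. Qed.

Lemma findimD u v : A u -> A v -> A (u + v).
Proof. by move=> Au Av; rewrite -[u]scale1r; exact: findim_lin. Qed.

(* The hypothesis on [l] says that [l] kills the kernel of the matrix of [a]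
   in a generating family. *)
Lemma findim_solve (a : V -> V -> R) (l : V -> R) :
  (forall c u v w, A u -> A v -> A w -> a (c *: u + v) w = c * a u w + a v w) ->
  (forall c u v w, A u -> A v -> A w -> a w (c *: u + v) = c * a w u + a w v) ->
  (forall c u v, A u -> A v -> l (c *: u + v) = c * l u + l v) ->
  (forall v, A v -> a v v = 0 -> l v = 0) ->
  exists2 u, A u & forall v, A v -> a u v = l v.
Proof.
move=> al ar ll ker; have [n [b Ab]] := hA.
have Ac c : A (\sum_i c i *: b i) by rewrite Ab; exists c.
have Abi i : A (b i).
  rewrite Ab; exists (fun j => (j == i)%:R) => //.
  rewrite (bigD1 i)//= eqxx scale1r big1 ?addr0// => j /negPf ->.
  by rewrite scale0r.
have sumE (phi : V -> R) : phi 0 = 0 ->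
    (forall c u v, A u -> A v -> phi (c *: u + v) = c * phi u + phi v) ->
    forall c : 'I_n -> R, phi (\sum_i c i *: b i) = \sum_i c i * phi (b i).
  move=> phi0 philin c.
  (* Membership in [A] is carried along because [phi] is linear on [A] only. *)
  pose P (x : V) r := A x /\ phi x = r.
  suff [] : P (\sum_i c i *: b i) (\sum_i c i * phi (b i)) by [].
  apply: (big_ind2 P) => [|x r y s [Ax <-] [Ay <-]|i _].
  - by split => //; exact: findim0.
  - split; first exact: findimD.
    by rewrite -[x]scale1r philin// scale1r mul1r.
  - split; first by rewrite -[X in A X]addr0; apply: findim_lin => //; exact: findim0.
    by rewrite -[_ *: _]addr0 philin ?phi0 ?addr0//; exact: findim0.
have lin0 (phi : V -> R) : (forall c u v, A u -> A v ->
    phi (c *: u + v) = c * phi u + phi v) -> phi 0 = 0.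
  move=> philin; have := philin (-1) 0 0 findim0 findim0.
  by rewrite scaler0 addr0 mulN1r addNr.
have l0 : l 0 = 0 by exact: lin0.
have al0 w : A w -> a 0 w = 0.
  by move=> Aw; apply: (lin0 (a^~ w)) => c u v Au Av; exact: al.
have ar0 w : A w -> a w 0 = 0.
  by move=> Aw; apply: (lin0 (a w)) => c u v Au Av; exact: ar.
pose M : 'M[R]_n := \matrix_(i, j) a (b i) (b j).
pose L : 'rV[R]_n := \row_j l (b j).
(* Solvability of [c *m M = L]: the row [L] lies in the row space of [M] as soon as it kills the
   cokernel of [M]. *)
have /submxP[c Lc] : (L <= M)%MS.
  rewrite submxE; apply/eqP/rowP => k; rewrite !mxE.
  (* A column of the cokernel gives the coordinates of an [x] with [a (b i) x = 0] for every [i],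
     whence [a x x = 0]. *)
  pose x := \sum_j cokermx M j k *: b j.
  have Ax : A x by exact: Ac.
  have aix i : a (b i) x = 0.
    rewrite /x (sumE (a (b i)))//; last 2 first.
    - exact: ar0.
    - by move=> *; exact: ar.
    have /matrixP/(_ i k) := mulmx_coker M; rewrite !mxE => H; apply: etrans _ H.
    by apply: eq_bigr => j _; rewrite [M i j]mxE mulrC.
  have : l x = 0.
    apply: ker => //; rewrite {1}/x (sumE (a^~ x)).
    - by rewrite big1// => j _; rewrite aix mulr0.
    - exact: al0.
    - by move=> *; exact: al.
  rewrite /x sumE// => H; apply: etrans _ H.
  by apply: eq_bigr => j _; rewrite [L _ _]mxE mulrC.
exists (\sum_i c ord0 i *: b i) => // v.
rewrite {1}Ab => -[e _ <-].
rewrite (sumE l)// (sumE (a _)); last 2 first.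
- exact: ar0.
- by move=> *; exact: ar.
apply: eq_bigr => j _; congr (_ * _).
rewrite (sumE (a^~ (b j))); last 2 first.
- exact: al0.
- by move=> *; exact: al.
have /rowP/(_ j) := Lc; rewrite !mxE => ->.
by apply: eq_bigr => i _; rewrite mxE.
Qed.

End findim.

(** * The skew-symmetric form $b^*$ *)

Section bstar.
Context (R : realType) (d : nat) (Om : set 'rV[R]_d).
Hypotheses (mOm : measurable Om) (bOm : bounded_set Om).
Local Notation E := 'rV[R]_d.
Local Notation mu := (lebesgue_rV R d).
Implicit Types u v w : vfield R d.

Lemma triple_lin1 a u u' v w x :
  triple (a *: u + u') v w x = a * triple u v w x + triple u' v w x.
Proof.
rewrite !tripleE mulr_sumr -big_split; apply: eq_bigr => j _; rewrite [RHS]/=.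
rewrite mulrA mulr_sumr -mulrDl -big_split; congr (_ * _).
apply: eq_bigr => k _; rewrite [RHS]/= -[(a *: u + u').1 x]/(a *: u.1 x + u'.1 x) !mxE.
by rewrite mulrDl mulrA.
Qed.

Lemma triple_lin2 a u v v' w x :
  triple u (a *: v + v') w x = a * triple u v w x + triple u v' w x.
Proof.
rewrite !tripleE mulr_sumr -big_split; apply: eq_bigr => j _; rewrite [RHS]/=.
rewrite mulrA mulr_sumr -mulrDl -big_split; congr (_ * _).
apply: eq_bigr => k _; rewrite [RHS]/= -[(a *: v + v').2 x]/(a *: v.2 x + v'.2 x) !mxE.
by rewrite mulrDr mulrCA.
Qed.

Lemma triple_lin3 a u v w w' x :
  triple u v (a *: w + w') x = a * triple u v w x + triple u v w' x.
Proof.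
rewrite !tripleE mulr_sumr -big_split; apply: eq_bigr => j _; rewrite [RHS]/=.
rewrite -[(a *: w + w').1 x]/(a *: w.1 x + w'.1 x) !mxE.
by rewrite mulrDr mulrCA.
Qed.

Lemma bstar_diag u v : bstar Om u v v = 0.
Proof. exact: subrr. Qed.

(* No integrability is available here: the integrals may be junk. *)
Lemma eq_bstar1 u u' v w : X Om u -> X Om u' -> X Om v -> X Om w ->
  {ae mu, forall x, Om x -> u.1 x = u'.1 x} ->
  bstar Om u v w = bstar Om u' v w.
Proof.
move=> Xu Xu' Xv Xw uu'; rewrite /bstar.
have e y z : X Om y -> X Om z -> dotmx Om (conv u y) z.1 = dotmx Om (conv u' y) z.1.
  move=> Xy Xz; congr fine; apply: ae_eq_integral => //.
  - by apply/measurable_EFinP; exact: (measurable_triple Xu Xy Xz).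
  - by apply/measurable_EFinP; exact: (measurable_triple Xu' Xy Xz).
  - by apply: filterS uu' => x h Ox; rewrite /conv h.
by rewrite !e.
Qed.

(** Both integrands vanish almost everywhere, so the integrals are [0] even if [Mconst] is
    infinite. *)
Lemma bstar_null1 u v w : X Om u -> X Om v -> X Om w ->
  gradnorm Om u = 0 -> bstar Om u v w = 0.
Proof.
move=> Xu Xv Xw u0.
have e y z : X Om y -> X Om z -> dotmx Om (conv u y) z.1 = 0.
  move=> Xy Xz; rewrite /dotmx /Rintegral (ae_eq_integral (cst 0%E)) ?integral0//.
  - by apply/measurable_EFinP; exact: (measurable_triple Xu Xy Xz).
  - have := triple_ae0 mOm bOm Xu Xy Xz (or_introl u0).
    by apply: filterS => x h /h; rewrite /triple => ->.
by rewrite /bstar !e// mulr0 subrr.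
Qed.

Context (M : R).
Hypothesis MM : Mconst Om = M%:E.

Let tint u v w (Xu : X Om u) (Xv : X Om v) (Xw : X Om w) :=
  (Mconst_fin mOm bOm MM Xu Xv Xw).1.

Lemma Mconst_fin_ge0 : 0 <= M.
Proof. by rewrite -lee_fin -MM Mconst_ge0. Qed.

Lemma bstar_bound u v w : X Om u -> X Om v -> X Om w ->
  `|bstar Om u v w| <= M * gradnorm Om u * gradnorm Om v * gradnorm Om w.
Proof.
move=> Xu Xv Xw.
have [_ h1] := Mconst_fin mOm bOm MM Xu Xv Xw.
have [_ h2] := Mconst_fin mOm bOm MM Xu Xw Xv.
move: h1 h2; rewrite /bstar !ler_norml => /andP[? ?] /andP[? ?].
by apply/andP; split; lra.
Qed.

Lemma Rint_lin a (f g : E -> R) :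
  mu.-integrable Om (EFin \o f) -> mu.-integrable Om (EFin \o g) ->
  \int[mu]_(x in Om) (a * f x + g x) =
  a * \int[mu]_(x in Om) f x + \int[mu]_(x in Om) g x.
Proof.
move=> fi gi; rewrite -RintegralZl// -RintegralD//.
exact: (integrableZl mOm a fi).
Qed.

Lemma bstar_lin1 a u u' v w : X Om u -> X Om u' -> X Om v -> X Om w ->
  X Om (a *: u + u') ->
  bstar Om (a *: u + u') v w = a * bstar Om u v w + bstar Om u' v w.
Proof.
move=> Xu Xu' Xv Xw Xs; rewrite /bstar.
have e y z : X Om y -> X Om z -> dotmx Om (conv (a *: u + u') y) z.1 =
    a * dotmx Om (conv u y) z.1 + dotmx Om (conv u' y) z.1.
  move=> Xy Xz; rewrite -Rint_lin; last 2 first.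
  - exact: tint.
  - exact: tint.
  by apply: eq_Rintegral => x _; exact: triple_lin1.
by rewrite !e//; ring.
Qed.

Lemma dotconv_lin2 a u v v' w : X Om u -> X Om v -> X Om v' -> X Om w ->
  dotmx Om (conv u (a *: v + v')) w.1 =
    a * dotmx Om (conv u v) w.1 + dotmx Om (conv u v') w.1.
Proof.
move=> Xu Xv Xv' Xw; rewrite -Rint_lin; last 2 first.
- exact: tint.
- exact: tint.
by apply: eq_Rintegral => x _; exact: triple_lin2.
Qed.

Lemma dotconv_lin3 a u v w w' : X Om u -> X Om v -> X Om w -> X Om w' ->
  dotmx Om (conv u v) (a *: w + w').1 =
    a * dotmx Om (conv u v) w.1 + dotmx Om (conv u v) w'.1.
Proof.
move=> Xu Xv Xw Xw'; rewrite -Rint_lin; last 2 first.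
- exact: tint.
- exact: tint.
by apply: eq_Rintegral => x _; exact: triple_lin3.
Qed.

Lemma bstar_lin2 a u v v' w : X Om u -> X Om v -> X Om v' -> X Om w ->
  bstar Om u (a *: v + v') w = a * bstar Om u v w + bstar Om u v' w.
Proof.
by move=> *; rewrite /bstar dotconv_lin2// dotconv_lin3//; ring.
Qed.

Lemma bstar_lin3 a u v w w' : X Om u -> X Om v -> X Om w -> X Om w' ->
  bstar Om u v (a *: w + w') = a * bstar Om u v w + bstar Om u v w'.
Proof.
by move=> *; rewrite /bstar dotconv_lin2// dotconv_lin3//; ring.
Qed.

End bstar.

(** * The scheme *)

Section energy_inequalities.
Context (R : realType) (nu rho alpha : R).
Hypotheses (nu0 : 0 < nu) (rho0 : 0 < rho) (alpha0 : 0 < alpha).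

(** Expand $(\alpha s/2-\rho D)^2/\alpha\ge 0$. The weight of [D ^+ 2] is exactly that of the
    divergence term of the scheme, which absorbs it. *)
Lemma young_pressure (s D : R) :
  rho * (s * D) <= alpha * s ^+ 2 / 4 + rho ^+ 2 / alpha * D ^+ 2.
Proof.
have h : 0 <= (alpha * s / 2 - rho * D) ^+ 2 / alpha.
  by rewrite divr_ge0 ?sqr_ge0// ltW.
rewrite -subr_ge0; move: h; congr (_ <= _); field; exact: lt0r_neq0.
Qed.

(** Expand $(2\nu g-F)^2\rho/(4\nu)\ge 0$; the viscous term absorbs [rho * nu * g ^+ 2]. *)
Lemma young_load (F g : R) : rho * (F * g) <= rho * nu * g ^+ 2 + rho / nu * F ^+ 2 / 4.
Proof.
have h : 0 <= (2 * nu * g - F) ^+ 2 * (rho / nu / 4).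
  by rewrite mulr_ge0 ?sqr_ge0// !divr_ge0// ltW.
rewrite -subr_ge0; move: h; congr (_ <= _); field; exact: lt0r_neq0.
Qed.

(** Here [g] and [D] stand for the gradient and divergence norms of the solution, [a] and [s] for
    the norms of the data, [F] for that of the load. The Young inequalities leave $g^2\le
    S^2+T^2\le(S+T)^2$. *)
Lemma velocity_energy (a s F D g : R) : 0 <= a -> 0 <= F ->
  (1 + rho * nu) * g ^+ 2 + rho ^+ 2 / alpha * D ^+ 2 <=
    a * g + rho * (s * D) + rho * (F * g) ->
  g <= Num.sqrt (a ^+ 2 + alpha * s ^+ 2) + Num.sqrt (rho / nu) * F.
Proof.
move=> a0 F0 h.
have hs := young_pressure s D; have hF := young_load F g.
have ha : a * g <= a ^+ 2 / 2 + g ^+ 2 / 2.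
  by have := sqr_ge0 (a - g); nra.
have as0 : 0 <= alpha * s ^+ 2 by rewrite mulr_ge0 ?sqr_ge0// ltW.
have rn0 : 0 <= rho / nu by rewrite divr_ge0// ltW.
have F2 : 0 <= rho / nu * F ^+ 2 by rewrite mulr_ge0 ?sqr_ge0.
set S := Num.sqrt _; set T := Num.sqrt _ * F.
have S0 : 0 <= S by exact: sqrtr_ge0.
have T0 : 0 <= T by rewrite mulr_ge0 ?sqrtr_ge0.
have S2 : S ^+ 2 = a ^+ 2 + alpha * s ^+ 2.
  by rewrite sqr_sqrtr// addr_ge0 ?sqr_ge0.
have T2 : T ^+ 2 = rho / nu * F ^+ 2 by rewrite exprMn sqr_sqrtr.
have g2 : g ^+ 2 <= S ^+ 2 + T ^+ 2 by rewrite S2 T2; lra.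
have ST : 0 <= S * T by exact: mulr_ge0.
rewrite leNgt; apply/negP => lt.
have : (S + T) ^+ 2 < g ^+ 2 by rewrite ltr_pXn2r// nnegrE; lra.
by rewrite sqrrD; lra.
Qed.

(** Young's inequality for [2 * e] bounds twice the hypothesis, and half of the left-hand side is
    absorbed. *)
Lemma pressure_energy (e D : R) : 0 <= e -> 0 <= D ->
  alpha * e ^+ 2 <= rho * (D * e) -> alpha * e ^+ 2 <= rho ^+ 2 / alpha * D ^+ 2.
Proof.
move=> e0 D0 h; have := young_pressure (2 * e) D.
have : alpha * (2 * e) ^+ 2 / 4 = alpha * e ^+ 2 by field.
by move=> ->; lra.
Qed.

(** The divergence term controls the pressure, so the norm [H] satisfies $H^2\le Ag\le AH$. *)
Lemma remainder_energy (A e D g : R) : 0 <= e -> 0 <= D -> 0 <= g -> 0 <= A ->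
  (1 + rho * nu) * g ^+ 2 + rho ^+ 2 / alpha * D ^+ 2 <= A * g ->
  alpha * e ^+ 2 <= rho * (D * e) ->
  Num.sqrt (g ^+ 2 + alpha * e ^+ 2) <= A.
Proof.
move=> e0 D0 g0 A0 h /(pressure_energy e0 D0) he.
have ae0 : 0 <= alpha * e ^+ 2 by rewrite mulr_ge0 ?sqr_ge0// ltW.
have rng : 0 <= rho * nu * g ^+ 2 by rewrite !mulr_ge0 ?sqr_ge0// ltW.
set H := Num.sqrt _.
have H0 : 0 <= H by exact: sqrtr_ge0.
have H2 : H ^+ 2 = g ^+ 2 + alpha * e ^+ 2.
  by rewrite sqr_sqrtr// addr_ge0 ?sqr_ge0.
have gH : g <= H.
  by rewrite -(ler_pXn2r (n := 2)) ?nnegrE// H2 lerDl.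
have HA : H * H <= A * H.
  rewrite -expr2 H2; apply: le_trans (_ : A * g <= _); first by lra.
  exact: ler_wpM2l.
have [->//|Hn0] := eqVneq H 0.
by rewrite -(ler_pM2r (x := H)) // lt_def Hn0.
Qed.

(** The velocity estimate without load; [1 <= a] lets [a] be factored out of the pressure term
    too. *)
Lemma increment_energy (a W s D g : R) : 1 <= a -> 0 <= W ->
  (1 + rho * nu) * g ^+ 2 + rho ^+ 2 / alpha * D ^+ 2 <=
    a * W * g + rho * (s * D) ->
  g <= a * Num.sqrt (W ^+ 2 + alpha * s ^+ 2).
Proof.
move=> a1 W0 h; have a0 : 0 <= a by lra.
have as0 : 0 <= alpha * s ^+ 2 by rewrite mulr_ge0 ?sqr_ge0// ltW.
have := @velocity_energy (a * W) s 0 D g (mulr_ge0 a0 W0) (lexx _).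
rewrite mul0r !mulr0 !addr0 => /(_ h) /le_trans; apply.
have -> : a * Num.sqrt (W ^+ 2 + alpha * s ^+ 2) =
    Num.sqrt (a ^+ 2 * (W ^+ 2 + alpha * s ^+ 2)).
  by rewrite sqrtrM ?sqr_ge0// sqrtr_sqr ger0_norm.
apply: ler_wsqrtr.
have : 1 <= a ^+ 2 by rewrite expr_ge1.
by move: (s ^+ 2) as0 => ? ? ?; nra.
Qed.

End energy_inequalities.

(** * The discrete equations and null increments *)

Section scheme.
Context (R : realType) (d : nat) (Om : set 'rV[R]_d).
Hypotheses (mOm : measurable Om) (bOm : bounded_set Om).
Context (f : vfield R d -> R) (hf : dualX Om f).
Local Notation mu := (lebesgue_rV R d).

(** [dualX] bounds [f] by the full $H^1$ norm; Poincare's inequality turns this into a gradient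
    bound, so the supremum is taken over a bounded set. *)
Lemma dualnorm_spec : 0 <= dualnorm Om f /\
  forall v, X Om v -> `|f v| <= dualnorm Om f * gradnorm Om v.
Proof.
have [_ [C fC]] := hf; have [P P0 hP] := poincare mOm bOm.
have fb v : X Om v -> `|f v| <= `|C| * P * gradnorm Om v.
  move=> Xv; apply: le_trans (fC _ Xv) _; rewrite -mulrA.
  apply: le_trans (ler_wpM2l (normr_ge0 C) (hP _ Xv)).
  by rewrite ler_wpM2r ?sqrtr_ge0// ler_norm.
rewrite /dualnorm; set S := (S in sup S).
have ubS : has_ubound S.
  exists (`|C| * P) => _ [v [Xv /(contra_not (gradnorm_eq0P mOm bOm Xv).1) v0 ->]].
  rewrite ler_pdivrMr; first exact: fb.
  by rewrite lt_def gradnorm_ge0 andbT; exact/eqP.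
split.
  (* If every field of [X] is null the set is empty, and its [sup] is [0]. *)
  have [->|/set0P[z Sz]] := eqVneq S set0; first by rewrite sup0.
  apply: le_trans (ub_le_sup ubS Sz).
  by case: Sz => v [_ _ ->]; rewrite divr_ge0// gradnorm_ge0.
move=> v Xv; have [v0|v0] := eqVneq (gradnorm Om v) 0.
  by have := fb _ Xv; rewrite v0 !mulr0.
rewrite -ler_pdivrMr; last by rewrite lt_def v0 gradnorm_ge0.
apply: ub_le_sup => //; exists v; split => //.
by move/(gradnorm_eq0P mOm bOm Xv)/eqP; rewrite (negPf v0).
Qed.

Context (Xh : set (vfield R d)) (hXh : findim_subspace Xh) (hXhX : Xh `<=` X Om).
Context (Qh : set ('rV[R]_d -> R)) (hQh : findim_subspace Qh) (hQhQ : Qh `<=` Q Om).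
Context (nu rho alpha : R).
Hypotheses (nu0 : 0 < nu) (rho0 : 0 < rho) (alpha0 : 0 < alpha).

Local Notation V := (vfield R d).
Local Notation P := ('rV[R]_d -> R).
Local Notation G := (Defs.G Om f Xh Qh nu rho alpha).
Local Notation G' := (Defs.G' Om f Xh Qh nu rho alpha).
Local Notation gn := (gradnorm Om).
Implicit Types u v w : V.

Lemma Qh_L2 q : Qh q -> L2 Om q.
Proof. by move=> /hQhQ[]. Qed.

Lemma Xh_L2mx2 v : Xh v -> L2mx Om v.2.
Proof. by move=> /hXhX; exact: X_L2mx2. Qed.

Lemma Xh_L2div v : Xh v -> L2 Om (div v).
Proof. by move=> /hXhX; exact: X_L2div. Qed.

Lemma div_lin a u v : div (a *: u + v) = a *: div u + div v.
Proof.
apply/funext => x; rewrite /div -[(a *: u + v).2 x]/(a *: u.2 x + v.2 x).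
by rewrite mxtraceD mxtraceZ.
Qed.

Lemma grad_lin a u v w : Xh u -> Xh v -> Xh w ->
  dotmx Om (a *: u + v).2 w.2 = a * dotmx Om u.2 w.2 + dotmx Om v.2 w.2.
Proof.
move=> Xu Xv Xw.
exact: (dotmx_lin mOm a (Xh_L2mx2 Xu) (Xh_L2mx2 Xv) (Xh_L2mx2 Xw)).
Qed.

Lemma gradB u v w : Xh u -> Xh v -> Xh w ->
  dotmx Om (u - v).2 w.2 = dotmx Om u.2 w.2 - dotmx Om v.2 w.2.
Proof.
by move=> *; rewrite addrC -scaleN1r grad_lin// mulN1r addrC.
Qed.

Lemma gradD u v w : Xh u -> Xh v -> Xh w ->
  dotmx Om (u + v).2 w.2 = dotmx Om u.2 w.2 + dotmx Om v.2 w.2.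
Proof. by move=> *; rewrite -[u]scale1r grad_lin// mul1r scale1r. Qed.

Lemma grad_CS u v : Xh u -> Xh v -> `|dotmx Om u.2 v.2| <= gn u * gn v.
Proof. by move=> *; apply: (dotmx_CS mOm); exact: Xh_L2mx2. Qed.

(** The terms in the unknown velocity that [G], after multiplication by [rho], and [G'] have in
    common. *)
Definition form x u v : R := (1 + rho * nu) * dotmx Om u.2 v.2
  + rho * bstar Om x u v + rho ^+ 2 / alpha * dot Om (div u) (div v).

Lemma form_diag x v : form x v v =
  (1 + rho * nu) * gn v ^+ 2 + rho ^+ 2 / alpha * L2norm Om (div v) ^+ 2.
Proof. by rewrite /form bstar_diag mulr0 addr0 gradnorm_sqr L2norm_sqr. Qed.

Lemma form_diag_eq0 x v : form x v v = 0 -> gn v = 0 /\ L2norm Om (div v) = 0.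
Proof.
rewrite form_diag.
have c1 : 0 < 1 + rho * nu by rewrite addr_gt0// mulr_gt0.
have c2 : 0 < rho ^+ 2 / alpha by rewrite divr_gt0// exprn_gt0.
have h1 := mulr_ge0 (ltW c1) (sqr_ge0 (gn v)).
have h2 := mulr_ge0 (ltW c2) (sqr_ge0 (L2norm Om (div v))).
move=> h; split; apply/eqP; rewrite -sqrf_eq0.
  have /eqP : (1 + rho * nu) * gn v ^+ 2 = 0 by lra.
  by rewrite mulf_eq0 gt_eqF.
have /eqP : rho ^+ 2 / alpha * L2norm Om (div v) ^+ 2 = 0 by lra.
by rewrite mulf_eq0 gt_eqF.
Qed.

(** The momentum equation is multiplied by [rho]; the test pairs [(v, 0)] and [(0, q)] separate the
    two equations. *)
Lemma G_specP x y : (Xh `*` Qh) x -> (Xh `*` Qh) y ->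
  G_spec Om f Xh Qh nu rho alpha x y <->
  (forall v, Xh v -> form x.1 y.1 v =
      rho * f v + dotmx Om x.1.2 v.2 + rho * dot Om x.2 (div v)) /\
  (forall q, Qh q -> alpha * dot Om (y.2 - x.2) q + rho * dot Om (div y.1) q = 0).
Proof.
move=> [Xx Qx] [Xy Qy].
have e v : Xh v -> form x.1 y.1 v - (rho * f v + dotmx Om x.1.2 v.2
    + rho * dot Om x.2 (div v)) = rho * (rho^-1 * dotmx Om (y.1 - x.1).2 v.2
        + nu * dotmx Om y.1.2 v.2
        + bstar Om x.1 y.1 v + rho / alpha * dot Om (div y.1) (div v)
        - dot Om x.2 (div v) - f v).
  move=> Xv; rewrite gradB// /form; field.
  by rewrite !gt_eqF.
have rn0 : rho != 0 by rewrite gt_eqF.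
split => [h|[h1 h2] v q Xv Qq].
  split => [v Xv|q Qq]; last by have [] := h 0 q (findim0 hXh) Qq.
  have [/eqP h1 _] := h v 0 Xv (findim0 hQh).
  move: h1; rewrite -subr_eq0 => /eqP h1; apply/eqP; rewrite -subr_eq0 e// h1.
  by rewrite mulr0.
split; last exact: h2.
apply/eqP; rewrite -subr_eq0; have /eqP := h1 v Xv.
by rewrite -subr_eq0 e// mulf_eq0 (negPf rn0).
Qed.

Lemma G'_specP x h y : (Xh `*` Qh) h -> (Xh `*` Qh) y ->
  G'_spec Om f Xh Qh nu rho alpha x h y <->
  (forall v, Xh v -> form x.1 y.1 v = dotmx Om h.1.2 v.2
      + rho * dot Om h.2 (div v) - rho * bstar Om h.1 (G x).1 v) /\
  (forall q, Qh q -> alpha * dot Om (y.2 - h.2) q + rho * dot Om (div y.1) q = 0).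
Proof.
move=> [Xx Qx] [Xy Qy].
have e v : Xh v -> form x.1 y.1 v - (dotmx Om h.1.2 v.2
      + rho * dot Om h.2 (div v) - rho * bstar Om h.1 (G x).1 v) =
    dotmx Om (y.1 - h.1).2 v.2 + rho * nu * dotmx Om y.1.2 v.2
        + rho * bstar Om x.1 y.1 v + rho * bstar Om h.1 (G x).1 v
        + rho ^+ 2 / alpha * dot Om (div y.1) (div v)
        - rho * dot Om h.2 (div v).
  by move=> Xv; rewrite gradB// /form; ring.
split => [hh|[h1 h2] v q Xv Qq].
  split => [v Xv|q Qq]; last by have [] := hh 0 q (findim0 hXh) Qq.
  have [h1 _] := hh v 0 Xv (findim0 hQh).
  by apply/eqP; rewrite -subr_eq0 e// h1.
split; last exact: h2.
by have /eqP := h1 v Xv; rewrite -subr_eq0 e// => /eqP.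
Qed.

Lemma null_bound (c g z : R) : `|z| <= c * g -> g = 0 -> z = 0.
Proof. by move=> + g0; rewrite g0 mulr0 normr_le0 => /eqP. Qed.

Lemma Hnorm_sqr (y : V * P) :
  Hnorm Om alpha y ^+ 2 = gn y.1 ^+ 2 + alpha * L2norm Om y.2 ^+ 2.
Proof.
by rewrite sqr_sqrtr// addr_ge0 ?sqr_ge0// mulr_ge0 ?sqr_ge0// ltW.
Qed.

Lemma gn_le_Hnorm (y : V * P) : gn y.1 <= Hnorm Om alpha y.
Proof.
rewrite -(ler_pXn2r (n := 2)) ?nnegrE ?gradnorm_ge0 ?sqrtr_ge0//.
by rewrite Hnorm_sqr lerDl (mulr_ge0 (ltW alpha0) (sqr_ge0 _)).
Qed.

Lemma Hnorm_eq0 (y : V * P) :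
  Hnorm Om alpha y = 0 -> gn y.1 = 0 /\ L2norm Om y.2 = 0.
Proof.
move=> y0; have := Hnorm_sqr y; rewrite y0 expr0n/= => e.
have h1 := sqr_ge0 (gn y.1).
have h2 := mulr_ge0 (ltW alpha0) (sqr_ge0 (L2norm Om y.2)).
split; apply/eqP; rewrite -sqrf_eq0; first by apply/eqP; lra.
have /eqP : alpha * L2norm Om y.2 ^+ 2 = 0 by lra.
by rewrite mulf_eq0 gt_eqF.
Qed.

Lemma HnormN (y : V * P) : Hnorm Om alpha (- y) = Hnorm Om alpha y.
Proof.
have e1 : gn (- y).1 = gn y.1.
  congr Num.sqrt; apply: eq_Rintegral => x _; apply: eq_bigr => i _.
  apply: eq_bigr => j _.
  by rewrite -[(- y).1.2 x]/(- (y.1.2 x)) !mxE mulrNN.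
have e2 : L2norm Om (- y).2 = L2norm Om y.2.
  congr Num.sqrt; apply: eq_Rintegral => x _.
  by rewrite -[(- y).2 x]/(- (y.2 x)) mulrNN.
by rewrite /Hnorm e1 e2.
Qed.

(** The default value [0] of [xget] also lies in the product space, so this holds whether or not a
    solution exists. *)
Lemma G_in x : (Xh `*` Qh) (G x).
Proof.
have [ex|/forallNP nex] := pselect
    (exists y, [set y | (Xh `*` Qh) y /\ G_spec Om f Xh Qh nu rho alpha x y] y).
  by have [] := xgetPex 0 ex.
rewrite [G x]xgetPN//.
by split; [exact: (findim0 hXh)|exact: (findim0 hQh)].
Qed.

(* The case of a null increment must be treated without the trilinear bound,
   since [Mconst Om] is not known to be finite. *)
Lemma G_null_increment x h : (Xh `*` Qh) x -> (Xh `*` Qh) h ->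
  Hnorm Om alpha h = 0 ->
  G (x + h) = G x /\ Hnorm Om alpha (G' x h) = 0.
Proof.
move=> Hx Hh /Hnorm_eq0[h10 h20]; have [[Xx Qx] [Xh1 Qh2]] := (Hx, Hh).
have Hxh : (Xh `*` Qh) (x + h) by split; exact: findimD.
have [Xxh Qxh] := Hxh.
have dh v : Xh v -> dotmx Om h.1.2 v.2 = 0.
  by move=> Xv; have := grad_CS Xh1 Xv; rewrite mulrC => /null_bound; apply.
have sh q : L2 Om q -> dot Om h.2 q = 0.
  by move=> Lq; have := dot_CS mOm (Qh_L2 Qh2) Lq; rewrite mulrC => /null_bound; apply.
split.
  (* [G] is a choice among solutions, so equality of the values is drawn from equality of the two
     solution sets. *)
  rewrite /Defs.G; congr (xget _ _); apply/seteqP.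
  have fE y v : Xh y -> Xh v -> form (x + h).1 y v = form x.1 y v.
    move=> Xy Xv; rewrite /form (eq_bstar1 mOm (u' := x.1)) //; do ?exact: hXhX.
    have /(gradnorm_eq0P mOm bOm (hXhX Xh1)) := h10.
    by apply: filterS => z hz Oz; rewrite -[(x + h).1.1 z]/(x.1.1 z + h.1.1 z) hz// addr0.
  have gE v : Xh v -> dotmx Om (x + h).1.2 v.2 = dotmx Om x.1.2 v.2.
    by move=> Xv; rewrite (gradD Xx Xh1 Xv) dh// addr0.
  have qE q : L2 Om q -> dot Om (x + h).2 q = dot Om x.2 q.
    by move=> Lq; rewrite (dotDl mOm (Qh_L2 Qx) (Qh_L2 Qh2) Lq) sh// addr0.
  have sE y q : Qh y -> Qh q -> dot Om (y - (x + h).2) q = dot Om (y - x.2) q.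
    move=> Qy Qq; rewrite !(dotBl mOm) ?qE//; exact: Qh_L2.
  by split => y [Hy]; have [Xy Qy] := Hy => h0; split => //;
    [apply/(G_specP Hx Hy); have [h1 h2] := (G_specP Hxh Hy).1 h0
    |apply/(G_specP Hxh Hy); have [h1 h2] := (G_specP Hx Hy).1 h0];
    split => [v Xv|q Qq]; do ?[have := h2 q Qq; rewrite sE//|
      have := h1 v Xv; rewrite fE// gE// qE//; exact: Xh_L2div].
(* If the problem for [G'] has no solution, [xget] returns [0], whose norm is zero. *)
have [ex|/forallNP nex] := pselect (exists y,
    [set y | (Xh `*` Qh) y /\ G'_spec Om f Xh Qh nu rho alpha x h y] y); last first.
  rewrite [G' x h]xgetPN//.
  have L20 : dot Om 0 0 = 0.
    by rewrite /dot /Rintegral integral0_eq// => z _; rewrite mulr0.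
  have g0 : dotmx Om (0 : V).2 (0 : V).2 = 0.
    rewrite /dotmx /Rintegral integral0_eq// => z _; congr EFin.
    by apply: big1 => i _; apply: big1 => j _; rewrite mxE mulr0.
  rewrite /Hnorm /gradnorm /L2normmx /L2norm g0.
  by rewrite -[(0 : V * P).2]/(0 : P) L20 !sqrtr0 expr0n mulr0 addr0 sqrtr0.
have [HD SD] := xgetPex 0 ex; rewrite -/(G' x h) in HD SD.
have [XD QD] := HD; have [D1 D2] := (G'_specP x Hh HD).1 SD.
have [XG _] := G_in x.
(* Testing with the velocity itself: the right-hand side vanishes, hence so do the gradient and the
   divergence, and then the pressure. *)
have := D1 _ XD.
rewrite dh// sh ?(bstar_null1 mOm bOm)//; do ?[exact: hXhX|exact: Xh_L2div].
rewrite !mulr0 addr0 subr0 => /form_diag_eq0[g0 d0].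
have /eqP : dot Om (G' x h).2 (G' x h).2 = 0.
  have := D2 _ QD; rewrite (dotBl mOm); do ?exact: Qh_L2.
  have -> : dot Om (div (G' x h).1) (G' x h).2 = 0.
    by have := dot_CS mOm (Xh_L2div XD) (Qh_L2 QD); rewrite mulrC => /null_bound; apply.
  rewrite sh; last exact: Qh_L2.
  by rewrite subr0 mulr0 addr0 => /eqP; rewrite mulf_eq0 gt_eqF//= => /eqP.
rewrite -L2norm_sqr sqrf_eq0 => /eqP e0.
by rewrite /Hnorm g0 e0 expr0n mulr0 addr0 sqrtr0.
Qed.

(** * Solvability and estimates for finite [Mconst] *)

Context (M : R).
Hypothesis MM : Mconst Om = M%:E.

Let M0 : 0 <= M := Mconst_fin_ge0 MM.

Lemma dotdiv_lin1 a u v g : Xh u -> Xh v -> L2 Om g ->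
  dot Om (div (a *: u + v)) g = a * dot Om (div u) g + dot Om (div v) g.
Proof.
by move=> Xu Xv Lg; rewrite div_lin; apply: (dot_lin mOm a) => //; exact: Xh_L2div.
Qed.

Lemma dotdiv_lin2 a u v g : Xh u -> Xh v -> L2 Om g ->
  dot Om g (div (a *: u + v)) = a * dot Om g (div u) + dot Om g (div v).
Proof. by move=> *; rewrite ![dot Om g _]dotC dotdiv_lin1. Qed.

Lemma form_lin1 a x u v w : Xh x -> Xh u -> Xh v -> Xh w ->
  form x (a *: u + v) w = a * form x u w + form x v w.
Proof.
move=> Xx Xu Xv Xw; rewrite /form grad_lin// dotdiv_lin1//; last exact: Xh_L2div.
rewrite (bstar_lin2 mOm bOm MM a); do ?exact: hXhX.
by ring.
Qed.

Lemma form_lin2 a x u v w : Xh x -> Xh u -> Xh v -> Xh w ->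
  form x w (a *: u + v) = a * form x w u + form x w v.
Proof.
move=> Xx Xu Xv Xw; rewrite /form 3!(dotmxC Om w.2) grad_lin// dotdiv_lin2//;
  last exact: Xh_L2div.
rewrite (bstar_lin3 mOm bOm MM a); do ?exact: hXhX.
by ring.
Qed.

Lemma formB x u v w : Xh x -> Xh u -> Xh v -> Xh w ->
  form x (u - v) w = form x u w - form x v w.
Proof.
by move=> *; rewrite addrC -scaleN1r form_lin1// mulN1r addrC.
Qed.

Lemma bstarD1 u v w z : Xh u -> Xh v -> Xh w -> Xh z ->
  bstar Om (u + v) w z = bstar Om u w z + bstar Om v w z.
Proof.
move=> Xu Xv Xw Xz; rewrite -[u]scale1r (bstar_lin1 mOm bOm MM); do ?exact: hXhX.
  by rewrite mul1r scale1r.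
by rewrite scale1r; apply: hXhX; exact: findimD.
Qed.

Lemma bstarB2 u v w z : Xh u -> Xh v -> Xh w -> Xh z ->
  bstar Om u (v - w) z = bstar Om u v z - bstar Om u w z.
Proof.
move=> Xu Xv Xw Xz; rewrite addrC -scaleN1r (bstar_lin2 mOm bOm MM);
  do ?exact: hXhX.
by rewrite mulN1r addrC.
Qed.

(** The new pressure does not enter the momentum equation, so the velocity [U] is found first. The
    pressure is then [p + r], with [r] the $L^2$ projection of $-(\rho/\alpha)\nabla\cdot U$ onto
    [Qh]. *)
Lemma scheme_solve x p (l : V -> R) : Xh x -> Qh p ->
  (forall a u v, Xh u -> Xh v -> l (a *: u + v) = a * l u + l v) ->
  (forall v, Xh v -> gn v = 0 -> L2norm Om (div v) = 0 -> l v = 0) ->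
  exists y : V * P, [/\ (Xh `*` Qh) y,
    forall v, Xh v -> form x y.1 v = l v &
    forall q, Qh q -> alpha * dot Om (y.2 - p) q + rho * dot Om (div y.1) q = 0].
Proof.
move=> Xx Qp llin l0.
have [|||| U XU hU] := @findim_solve R V Xh hXh (form x) l.
- by move=> *; exact: form_lin1.
- by move=> *; exact: form_lin2.
- exact: llin.
- by move=> v Xv /form_diag_eq0[g0 d0]; exact: l0.
have LU := Xh_L2div XU.
have [|||| r Qr hr] := @findim_solve R P Qh hQh (dot Om)
    (fun q => - (rho / alpha) * dot Om (div U) q).
- by move=> c u v w Qu Qv Qw; apply: (dot_lin mOm); exact: Qh_L2.
- move=> c u v w Qu Qv Qw; rewrite ![dot Om w _]dotC.
  by apply: (dot_lin mOm); exact: Qh_L2.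
- move=> c u v Qu Qv; rewrite ![dot Om (div U) _]dotC.
  by rewrite (dot_lin mOm) ?mulrDr ?(mulrCA c)//; exact: Qh_L2.
- move=> q Qq q0; have := dot_CS mOm LU (Qh_L2 Qq).
  by rewrite /L2norm q0 sqrtr0 mulr0 normr_le0 => /eqP ->; rewrite mulr0.
exists (U, p + r); split => //=; first by split => //; exact: findimD.
move=> q Qq; rewrite [p + r]addrC addrK hr//; field; exact: lt0r_neq0.
Qed.

Lemma G_solves x : (Xh `*` Qh) x -> [/\ (Xh `*` Qh) (G x),
  forall v, Xh v -> form x.1 (G x).1 v =
      rho * f v + dotmx Om x.1.2 v.2 + rho * dot Om x.2 (div v) &
  forall q, Qh q ->
    alpha * dot Om ((G x).2 - x.2) q + rho * dot Om (div (G x).1) q = 0].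
Proof.
move=> Hx; have [Xx Qx] := Hx.
have [|| y [Hy y1 y2]] := @scheme_solve x.1 x.2 (fun v => rho * f v
    + dotmx Om x.1.2 v.2 + rho * dot Om x.2 (div v)) Xx Qx.
- move=> a u v Xu Xv; have [flin _] := hf; rewrite flin; do ?exact: hXhX.
  rewrite dotdiv_lin2//; last exact: Qh_L2.
  by rewrite 3!(dotmxC Om x.1.2) grad_lin//; ring.
(* Each term of the right-hand side is bounded by the gradient or the divergence norm of [v], hence
   vanishes on the kernel. *)
- move=> v Xv g0 d0.
  rewrite (null_bound (dualnorm_spec.2 _ (hXhX Xv)) g0).
  rewrite (null_bound (grad_CS Xx Xv) g0).
  rewrite (null_bound (dot_CS mOm (Qh_L2 Qx) (Xh_L2div Xv)) d0).
  by rewrite !mulr0 !addr0.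
have [HG GG] : [set y | (Xh `*` Qh) y /\ G_spec Om f Xh Qh nu rho alpha x y] (G x).
  by apply: xgetPex; exists y; split => //; apply/(G_specP Hx Hy).
by have [] := (G_specP Hx HG).1 GG.
Qed.

Lemma G'_solves x h : (Xh `*` Qh) x -> (Xh `*` Qh) h ->
  [/\ (Xh `*` Qh) (G' x h),
  forall v, Xh v -> form x.1 (G' x h).1 v = dotmx Om h.1.2 v.2
      + rho * dot Om h.2 (div v) - rho * bstar Om h.1 (G x).1 v &
  forall q, Qh q ->
    alpha * dot Om ((G' x h).2 - h.2) q + rho * dot Om (div (G' x h).1) q = 0].
Proof.
move=> Hx Hh; have [[Xx Qx] [Xh1 Qh2]] := (Hx, Hh).
have [[XG QG] _ _] := G_solves Hx.
have [|| y [Hy y1 y2]] := @scheme_solve x.1 h.2 (fun v => dotmx Om h.1.2 v.2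
      + rho * dot Om h.2 (div v) - rho * bstar Om h.1 (G x).1 v) Xx Qh2.
- move=> a u v Xu Xv; rewrite (bstar_lin3 mOm bOm MM); do ?exact: hXhX.
  rewrite dotdiv_lin2//; last exact: Qh_L2.
  by rewrite 3!(dotmxC Om h.1.2) grad_lin//; ring.
- move=> v Xv g0 d0.
  rewrite (null_bound (grad_CS Xh1 Xv) g0).
  rewrite (null_bound (dot_CS mOm (Qh_L2 Qh2) (Xh_L2div Xv)) d0).
  rewrite (null_bound (bstar_bound mOm bOm MM (hXhX Xh1) (hXhX XG) (hXhX Xv)) g0).
  by rewrite !mulr0 !addr0 subrr.
have [HG GG] : [set y | (Xh `*` Qh) y /\ G'_spec Om f Xh Qh nu rho alpha x h y]
    (G' x h).
  by apply: xgetPex; exists y; split => //; apply/(G'_specP x Hh Hy).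
by have [] := (G'_specP x Hh HG).1 GG.
Qed.

(** Testing with the solution itself removes the trilinear term, so the bound is free of [M]. *)
Lemma G_stable x : (Xh `*` Qh) x ->
  gn (G x).1 <= Hnorm Om alpha x + Num.sqrt (rho / nu) * dualnorm Om f.
Proof.
move=> Hx; have [Xx Qx] := Hx; have [[XG QG] G1 _] := G_solves Hx.
have [F0 hF] := dualnorm_spec.
apply: (velocity_energy nu0 rho0 alpha0 (gradnorm_ge0 Om x.1) F0
  (D := L2norm Om (div (G x).1))).
rewrite -(form_diag x.1) G1//.
have h1 := le_trans (ler_norm _) (grad_CS Xx XG).
have h2 := le_trans (ler_norm _) (dot_CS mOm (Qh_L2 Qx) (Xh_L2div XG)).
have h3 := le_trans (ler_norm _) (hF _ (hXhX XG)).
have := ler_wpM2l (ltW rho0) h2; have := ler_wpM2l (ltW rho0) h3.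
by lra.
Qed.

Lemma G_lipschitz x h : (Xh `*` Qh) x -> (Xh `*` Qh) h ->
  gn (G (x + h) - G x).1 <= (1 + rho * M * gn (G x).1) * Hnorm Om alpha h.
Proof.
move=> Hx Hh; have [[Xx Qx] [Xh1 Qh2]] := (Hx, Hh).
have Hxh : (Xh `*` Qh) (x + h) by split; exact: findimD.
have [[XG QG] G1 _] := G_solves Hx; have [[XG' QG'] G1' _] := G_solves Hxh.
set e := (G (x + h) - G x).1.
have Xe : Xh e by exact: findimB.
apply: (increment_energy nu0 rho0 alpha0 _ (gradnorm_ge0 Om h.1)
  (D := L2norm Om (div e))).
  by rewrite lerDl !mulr_ge0 ?gradnorm_ge0 ?(ltW rho0).
rewrite -(form_diag (x + h).1) {1}/e formB//; last exact: findimD.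
rewrite G1'//.
(* With [x + h] as advecting field the trilinear term in [e] alone vanishes; putting that field into
   the equation of [G x] costs [rho * bstar Om h.1 (G x).1 e]. *)
have -> : form (x + h).1 (G x).1 e = form x.1 (G x).1 e + rho * bstar Om h.1 (G x).1 e.
  by rewrite /form bstarD1//; ring.
rewrite G1//.
have -> : dotmx Om (x + h).1.2 e.2 = dotmx Om x.1.2 e.2 + dotmx Om h.1.2 e.2.
  by exact: gradD.
have -> : dot Om (x + h).2 (div e) = dot Om x.2 (div e) + dot Om h.2 (div e).
  by apply: (dotDl mOm); [exact: Qh_L2|exact: Qh_L2|exact: Xh_L2div].
have h1 := le_trans (ler_norm _) (grad_CS Xh1 Xe).
have h2 := le_trans (ler_norm _) (dot_CS mOm (Qh_L2 Qh2) (Xh_L2div Xe)).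
have := bstar_bound mOm bOm MM (hXhX Xh1) (hXhX XG) (hXhX Xe).
rewrite ler_norml => /andP[h3 _].
have := ler_wpM2l (ltW rho0) h2; have := ler_wpM2l (ltW rho0) h3.
by lra.
Qed.

Lemma div_sub u v : div (u - v) = div u - div v.
Proof. by rewrite addrC -scaleN1r div_lin scaleN1r addrC. Qed.

(** Moving the equation of [U1] from the field [u + w] to [u] produces the term in [(w, U1)], and
    the equation of [D] supplies the one in [(w, U0)]; the linear data cancel by the last
    hypothesis. *)
Lemma remainder_momentum u w U1 U0 D (l1 l0 lD : V -> R) :
  Xh u -> Xh w -> Xh U1 -> Xh U0 -> Xh D ->
  (forall v, Xh v -> form (u + w) U1 v = l1 v) ->
  (forall v, Xh v -> form u U0 v = l0 v) ->
  (forall v, Xh v -> form u D v = lD v - rho * bstar Om w U0 v) ->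
  (forall v, Xh v -> l1 v = l0 v + lD v) ->
  forall v, Xh v -> form u (U1 - U0 - D) v = - (rho * bstar Om w (U1 - U0) v).
Proof.
move=> Xu Xw X1 X0 XD e1 e0 eD el v Xv.
have X10 : Xh (U1 - U0) by exact: findimB.
rewrite (formB Xu X10 XD Xv) (formB Xu X1 X0 Xv) (bstarB2 Xw X1 X0 Xv).
have : form (u + w) U1 v = form u U1 v + rho * bstar Om w U1 v.
  by rewrite /form (bstarD1 Xu Xw X1 Xv); ring.
rewrite e1// e0// eD// el//.
move: (form u U1 v) (l0 v) (lD v) (bstar Om w U1 v) (bstar Om w U0 v).
by move=> A B C F G ABC; rewrite mulrBr; move: ABC; lra.
Qed.

Lemma remainder_pressure (U1 U0 D : V) (P1 P0 E p s q : P) :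
  Xh U1 -> Xh U0 -> Xh D -> Qh P1 -> Qh P0 -> Qh E -> Qh p -> Qh s -> Qh q ->
  alpha * dot Om (P1 - (p + s)) q + rho * dot Om (div U1) q = 0 ->
  alpha * dot Om (P0 - p) q + rho * dot Om (div U0) q = 0 ->
  alpha * dot Om (E - s) q + rho * dot Om (div D) q = 0 ->
  alpha * dot Om (P1 - P0 - E) q = - (rho * dot Om (div (U1 - U0 - D)) q).
Proof.
move=> X1 X0 XD /Qh_L2 L1 /Qh_L2 L0 /Qh_L2 LE /Qh_L2 Lp /Qh_L2 Ls /Qh_L2 Lq.
have D1 := Xh_L2div X1; have D0 := Xh_L2div X0; have DD := Xh_L2div XD.
rewrite (dotBl mOm L1 (L2D mOm Lp Ls) Lq) (dotDl mOm Lp Ls Lq).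
rewrite (dotBl mOm L0 Lp Lq) (dotBl mOm LE Ls Lq).
rewrite (dotBl mOm (L2B mOm L1 L0) LE Lq) (dotBl mOm L1 L0 Lq) !div_sub.
rewrite (dotBl mOm (L2B mOm D1 D0) DD Lq) (dotBl mOm D1 D0 Lq).
move: (dot Om P1 q) (dot Om P0 q) (dot Om E q) (dot Om p q) (dot Om s q).
move: (dot Om (div U1) q) (dot Om (div U0) q) (dot Om (div D) q).
by move=> *; lra.
Qed.

Lemma G_remainder x h : (Xh `*` Qh) x -> (Xh `*` Qh) h ->
  Hnorm Om alpha (G (x + h) - G x - G' x h) <=
    rho * M * gn h.1 * gn (G (x + h) - G x).1.
Proof.
move=> Hx Hh; have [[Xx Qx] [Xh1 Qh2]] := (Hx, Hh).
have Hxh : (Xh `*` Qh) (x + h) by split; exact: findimD.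
have [[XG QG] G1 G2] := G_solves Hx; have [[XG' QG'] G1' G2'] := G_solves Hxh.
have [[XD QD] D1 D2] := G'_solves Hx Hh.
move: (G (x + h)) (G x) (G' x h) => [U1 P1] [U0 P0] [D E] /=
  in XG QG G1 G2 XG' QG' G1' G2' XD QD D1 D2 *.
have Xd : Xh (U1 - U0) by exact: findimB.
have Xe : Xh (U1 - U0 - D) by exact: findimB.
have Qe : Qh (P1 - P0 - E) by apply: findimB => //; exact: findimB.
have he : form x.1 (U1 - U0 - D) (U1 - U0 - D) =
    - (rho * bstar Om h.1 (U1 - U0) (U1 - U0 - D)).
  apply: (remainder_momentum Xx Xh1 XG' XG XD G1' G1 D1 _ Xe) => v Xv.
  rewrite (gradD Xx Xh1 Xv).
  by rewrite (dotDl mOm (Qh_L2 Qx) (Qh_L2 Qh2) (Xh_L2div Xv)); ring.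
have pe := remainder_pressure XG' XG XD QG' QG QD Qx Qh2 Qe
  (G2' _ Qe) (G2 _ Qe) (D2 _ Qe).
change (Num.sqrt (gn (U1 - U0 - D) ^+ 2 + alpha * L2norm Om (P1 - P0 - E) ^+ 2)
  <= rho * M * gn h.1 * gn (U1 - U0)).
move: (U1 - U0) (U1 - U0 - D) (P1 - P0 - E) => dlt e q in Xe Xd Qe he pe *.
(* Here [A] is [rho * M * gn h.1 * gn dlt], from the bound on the trilinear source. *)
apply: (remainder_energy nu0 rho0 alpha0 (D := L2norm Om (div e))).
- exact: L2norm_ge0.
- exact: L2norm_ge0.
- exact: gradnorm_ge0.
- by rewrite !mulr_ge0 ?gradnorm_ge0 ?(ltW rho0).
- rewrite -(form_diag x.1) he -mulrN -!mulrA ler_pM2l// !mulrA.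
  apply: le_trans (bstar_bound mOm bOm MM (hXhX Xh1) (hXhX Xd) (hXhX Xe)).
  by rewrite -normrN ler_norm.
- rewrite L2norm_sqr pe -mulrN ler_pM2l//.
  apply: le_trans (dot_CS mOm (Xh_L2div Xe) (Qh_L2 Qe)).
  by rewrite -normrN ler_norm.
Qed.

End scheme.

Theorem lemma3p4 (R : realType) (d : nat) (hd : d = 2%N \/ d = 3%N)
  (Om : set 'rV[R]_d) (hOm : bounded_lipschitz_domain Om)
  (f : vfield R d -> R) (hf : dualX Om f)
  (Xh : set (vfield R d)) (hXh : findim_subspace Xh) (hXhX : Xh `<=` X Om)
  (Qh : set ('rV[R]_d -> R)) (hQh : findim_subspace Qh) (hQhQ : Qh `<=` Q Om)
  (nu rho alpha : R) (hnu : 0 < nu) (hrho : 0 < rho) (halpha : 0 < alpha)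
  (hK : 3 * d%:R / 2 * rho ^+ 2 < alpha)
  (hK' : d%:R * rho ^+ 2 / (1 + 2 * rho * nu) < alpha)
  (u w : vfield R d) (p s : 'rV[R]_d -> R)
  (hu : Xh u) (hp : Qh p) (hw : Xh w) (hs : Qh s) :
  ((Hnorm Om alpha
      (G Om f Xh Qh nu rho alpha (u + w, p + s)
       - G Om f Xh Qh nu rho alpha (u, p)
       - G' Om f Xh Qh nu rho alpha (u, p) (w, s)))%:E
   <= rho%:E * Mconst Om * CL Om f nu rho alpha (u, p)
      / (Num.sqrt (2 * K'const d nu rho alpha))%:E
      * (Hnorm Om alpha (w, s) ^+ 2)%:E)%E.
Proof.
have [_ oOm _ bOm _] := hOm; have mOm := open_measurable_rV oOm.
have Hx : (Xh `*` Qh) (u, p) by [].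
have Hh : (Xh `*` Qh) (w, s) by [].
rewrite -[(u + w, p + s)]/((u, p) + (w, s)).
set N := Hnorm Om alpha (w, s); set b := Hnorm Om alpha (u, p) +
  Num.sqrt (rho / nu) * dualnorm Om f.
have N0 : 0 <= N by exact: sqrtr_ge0.
have [F0 _] := dualnorm_spec mOm bOm hf.
have b0 : 0 <= b by rewrite addr_ge0 ?mulr_ge0 ?sqrtr_ge0.
have d0 : 0 < d%:R :> R by case: hd => ->; rewrite ltr0n.
have K0 : 0 < Kconst d rho alpha.
  rewrite /Kconst lt_min invr_gt0 ltr0n/=.
  have -> : 2^-1 - 3 * d%:R * rho ^+ 2 * alpha^-1 / 4 =
     (alpha - 3 * d%:R / 2 * rho ^+ 2) / (2 * alpha) by field; rewrite gt_eqF.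
  by rewrite divr_gt0 ?subr_gt0// mulr_gt0.
have K1 : Num.sqrt (Kconst d rho alpha) <= 1.
  rewrite -[leRHS]sqrtr1 ler_wsqrtr// /Kconst ge_min; apply/orP; left.
  by rewrite invf_le1// ler1n.
have sK0 : 0 < Num.sqrt (Kconst d rho alpha) by rewrite sqrtr_gt0.
have K'0 : 0 < K'const d nu rho alpha.
  rewrite /K'const lt_min invr_gt0 ltr0n andbT.
  have c0 : 0 < 1 + 2 * rho * nu by rewrite addr_gt0// !mulr_gt0.
  have -> : 2^-1 + rho * nu - d%:R * rho ^+ 2 * alpha^-1 / 2 =
     (alpha - d%:R * rho ^+ 2 / (1 + 2 * rho * nu)) * (1 + 2 * rho * nu) / (2 * alpha).
    by field; rewrite !gt_eqF.
  by rewrite divr_gt0 ?mulr_gt0// subr_gt0.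
set k := Num.sqrt (2 * _).
have k0 : 0 < k by rewrite sqrtr_gt0 mulr_gt0.
have k1 : k <= 1.
  rewrite -[leRHS]sqrtr1 ler_wsqrtr//.
  have : K'const d nu rho alpha <= 2^-1 by rewrite /K'const ge_min lexx orbT.
  by lra.
have s21 : 1 <= Num.sqrt 2 :> R by rewrite -[leLHS]sqrtr1 ler_wsqrtr// ler1n.
(* For a null increment both sides are [0]; the product of an infinite factor with [0] is [0]. *)
have [N00|Nn0] := eqVneq N 0.
  have [-> G'0] := G_null_increment mOm bOm f hXh hXhX hQh hQhQ hnu hrho halpha Hx Hh N00.
  by rewrite subrr sub0r HnormN G'0 N00 expr0n mule0.
have Np : 0 < N by rewrite lt_def Nn0.
have := Mconst_ge0 Om; rewrite /CL -/b; case MM : (Mconst Om) => [M| |]// M0.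
  rewrite lee_fin in M0.
  set c := Num.max (Num.sqrt (2 / Kconst d rho alpha))
    ((Num.sqrt (Kconst d rho alpha))^-1 * (1 + rho * M * b)).
  rewrite -!EFinM -EFin_max -/c inver gt_eqF// -!EFinM lee_fin.
  have h1 := G_remainder mOm bOm hf hXh hXhX hQh hQhQ hnu hrho halpha MM Hx Hh.
  have h2 := G_lipschitz mOm bOm hf hXh hXhX hQh hQhQ hnu hrho halpha MM Hx Hh.
  have h3 := G_stable mOm bOm hf hXh hXhX hQh hQhQ hnu hrho halpha MM Hx.
  have rM0 : 0 <= rho * M by rewrite mulr_ge0// ltW.
  set B := 1 + rho * M * b.
  have B0 : 0 <= B by rewrite addr_ge0// mulr_ge0.
  (* [B] is below the second entry of the maximum because $\sqrt K\le 1$, and the factor $\sqrt 2$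
     only enlarges it. *)
  have Bc : B <= Num.sqrt 2 * c.
    have BC : B <= c.
      rewrite le_max; apply/orP; right; rewrite -/B ler_pdivlMl//.
      by rewrite ler_piMl.
    by apply: (le_trans BC); rewrite ler_peMl// (le_trans B0 BC).
  (* The stability bound [b] is inserted into the Lipschitz bound. *)
  have h4 : gradnorm Om (G Om f Xh Qh nu rho alpha ((u, p) + (w, s)) -
      G Om f Xh Qh nu rho alpha (u, p)).1 <= B * N.
    apply: le_trans h2 _; rewrite ler_wpM2r// lerD2l ler_wpM2l//.
  apply: le_trans h1 _; apply: le_trans (_ : rho * M * N * (B * N) <= _).
    apply: ler_pM => //; rewrite ?mulr_ge0 ?gradnorm_ge0 ?(ltW hrho)//.
    by rewrite ler_wpM2l// gn_le_Hnorm.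
  have -> : rho * M * N * (B * N) = rho * M * B * N ^+ 2 by ring.
  rewrite ler_wpM2r ?sqr_ge0// ler_pdivlMr//.
  have rMB : 0 <= rho * M * B by rewrite mulr_ge0.
  (* The denominator has been moved to the left, where [k <= 1] disposes of it. *)
  apply: le_trans (_ : rho * M * B <= _); first by rewrite ler_piMr.
  by rewrite ler_wpM2l.
(* Infinite [Mconst]: the remaining factors are positive, [C] through the first entry of its
   maximum, so the right-hand side is [+oo]. *)
set C := (_ * maxe _ _)%E.
have C0 : (0 < C)%E.
  rewrite mule_gt0 ?lte_fin ?(lt_le_trans ltr01 s21)// lt_max; apply/orP; left.
  by rewrite lte_fin sqrtr_gt0 divr_gt0.
have ik0 : (0 < k%:E^-1)%E by rewrite inver gt_eqF// lte_fin invr_gt0.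
have N20 : (0 < (N ^+ 2)%:E)%E by rewrite lte_fin exprn_gt0.
by rewrite gt0_muley ?lte_fin// !gt0_mulye// leey.
Qed.
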